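(* Let $\mathcal M,\mathcal N$ be Hilbert spaces, let $A\in\mathbf L(\mathcal M)$ be such that $\sigma(A)\cap\mathbf S(\Lambda)=\emptyset$, and let $C\in\mathbf L(\mathcal M,\mathcal N)$. Let $$F(z)=C(I-zA)^{-\odot},\qquad K(z,w)=F(z)F(w)^*,\qquad z,w\in\mathbf V(\Lambda),$$ and let $\mathcal H(K)$ be the reproducing kernel Hilbert space of $\mathcal N$-valued DA functions associated with the positive kernel $K$. Then $Z_-$ is a bounded operator on $\mathcal H(K)$. Moreover, for every $t\in\mathbf S(\Lambda)$ the operator $tI-Z_-$ is invertible in $\mathbf L(\mathcal H(K))$.
   Context: Rhombic lattice: $\Lambda$ is a monohedral (edge-to-edge) tessellation of $\mathbb C$ by mutually congruent (nondegenerate) rhombi of side length 1, viewed as a planar graph with vertex set $\mathbf V(\Lambda)$, (undirected) edge set $\mathbf E(\Lambda)$ and face set $\mathbf F(\Lambda)$ (the rhombi). $\hat{\mathbf E}(\Lambda)=\{b-a:(a,b)\in\mathbf E(\Lambda)\}$ is the set of edge directions; it is finite and closed under $e\mapsto -e$. A path from $a$ to $b$ is a finite sequence $(z_0=a,z_1,\dots,z_N=b)$ of vertices with consecutive ones adjacent; it is closed if $a=b$. Standing assumptions: $0\in\mathbf V(\Lambda)$; $1\in\hat{\mathbf E}(\Lambda)$; and both sides of every track $F$ in $\Lambda$ contain tracks that are coherent to $F$. Here a track is a sequence $(F_n)_{n\in\mathbb Z}$ of faces such that for every $n$ the faces $F_n,F_{n+1}$ are adjacent and the edges shared by $F_n$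 with $F_{n+1}$ and with $F_{n-1}$ are two opposite sides of $F_n$; these shared edges are the ties of the track. The sides of a track are the two connected components of the graph obtained by deleting all ties of the track from $\mathbf E(\Lambda)$. Two tracks are coherent if their ties are parallel. DA functions: for $f:\mathbf V(\Lambda)\to\mathcal V$ ($\mathcal V$ a complex vector space) and a path $\gamma=(z_0,\dots,z_N)$, $\int_\gamma f\,\delta z=\sum_{n=1}^N\frac{f(z_{n-1})+f(z_n)}{2}(z_n-z_{n-1})$. $f$ is discrete analytic (DA) if $\int_\gamma f\,\delta z=0$ for every closed path $\gamma$; $\int_a^b f\,\delta z$ denotes the then path-independent integral along any path from $a$ to $b$. $\mathcal H(\Lambda)$ is the space of ($\mathcal V$-valued) DA functions. Shifts: $(Z_+f)(z)=\frac{f(0)-f(z)}{2}+\int_0^z f\,\delta z$ maps $\mathcal H(\Lambda)$ to itself, and is injective with range $\{f\in\mathcal H(\Lambda):f(0)=0\}$. $Z_-g$ is the unique element of $\mathcal H(\Lambda)$ with $(Z_+Z_-g)(z)=g(z)-g(0)$. Notation: $\mathbf L(\mathcal M,\mathcal N)$ is the space of bounded linear operators, $\mathbf L(\mathcal M)=\mathbf L(\mathcal M,\mathcal M)$; $\mathbf S(\Lambda)=\{t\in\mathbb C:2+t(1-e)=0\text{ for some }e\in\hat{\mathbf E}(\Lambda)\}$. For $A\in\mathbf L(\mathcal M)$ with $\sigma(A)\cap\mathbf S(\Lambda)=\emptyset$, $(I-zA)^{-\odot}$ is the $\mathbf L(\mathcal M)$-valued DA function $G$ satisfying $G-(Z_+G)A=G-A(Z_+G)=I$,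 given by $G(z)=\prod_{k=1}^N\big((2I+(1+z_k-z_{k-1})A)(2I+(1+z_{k-1}-z_k)A)^{-1}\big)$ for any path $(z_0,\dots,z_N)$ from $0$ to $z$. *)

(* Defs.v *)
From HB Require Import structures.
From mathcomp Require Import all_boot all_order all_algebra.
From mathcomp Require Import complex.
From mathcomp Require Import all_classical all_reals all_analysis.

Set Implicit Arguments.
Unset Strict Implicit.
Unset Printing Implicit Defensive.

Import Order.TTheory GRing.Theory Num.Theory.
Import numFieldNormedType.Exports.

Local Open Scope classical_set_scope.
Local Open Scope ring_scope.

(* The complex numbers are [R[i]] for [R : realType].  Norms are [R[i]]-valued,
   and in the partial order of [R[i]] a bound [0 <= s <= 1] forces [s] to be
   real. *)

(** Hilbert spaces and bounded operators *)

HB.mixin Record CompleteNormedModule_isHilbert (R : realType) H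
    of CompleteNormedModule R[i] H := {
  (* linear in the first argument, conjugate-linear in the second *)
  hdot : {dot H for (@Num.conj R[i])} ;
  hdot_norm : forall x : H, hdot x x = `|x| ^+ 2
}.

#[short(type="hilbertType")]
HB.structure Definition Hilbert (R : realType) :=
  {H of CompleteNormedModule R[i] H & CompleteNormedModule_isHilbert R H}.

Section Operators.
Context {R : realType}.

(* Operators are plain functions, so that operator-valued functions take their
   values in the vector space [M -> N]; [bounded_op] is the subspace of bounded
   linear ones. *)
Definition bounded_op (M N : normedModType R[i]) : set (M -> N) :=
  [set T | linear T /\ exists c : R[i], forall x, `|T x| <= c * `|x|].

Definition invertible_op (M : normedModType R[i]) (T : M -> M) : Prop :=
  exists S : M -> M, [/\ bounded_op S, S \o T = id & T \o S = id].

Definition spectrum (M : normedModType R[i]) (A : M -> M) : set R[i] :=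
  [set l | ~ invertible_op (fun x => l *: x - A x)].

(* Meaningful for bounded [T], for which the adjoint exists and is unique. *)
Definition adjoint (M N : hilbertType R) (T : M -> N) : N -> M :=
  xget (fun=> 0) [set S | forall x y, hdot (T x) y = hdot x (S y)].

End Operators.

(** Rhombic lattices *)

Section Rhombi.
Context {R : realType}.
Implicit Types (P Q : set R[i]) (z w a b : R[i]).

Definition segment z w : set R[i] :=
  [set x | exists2 s, 0 <= s <= 1 & x = z + s * (w - z)].

Definition rhombus z a b : set R[i] :=
  [set x | exists s t, [/\ 0 <= s <= 1, 0 <= t <= 1 & x = z + s * a + t * b]].

(* [P] is the nondegenerate unit rhombus with corners [z], [z + a],
   [z + a + b], [z + b].  The region [P] determines its corners, and each
   corner [z] occurs with two choices of [(a, b)]. *)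
Definition rhombus_at P z a b : Prop :=
  [/\ `|a| = 1, `|b| = 1, a != b, a != - b & P = rhombus z a b].

Definition corner P z : Prop := exists a b, rhombus_at P z a b.

(* [z] and [w] are the endpoints of a side of [P]; symmetric in [z], [w]. *)
Definition side P z w : Prop := exists b, rhombus_at P z (w - z) b.

Definition congruent P Q : Prop :=
  exists2 phi : R[i] -> R[i],
    (forall x y, `|phi x - phi y| = `|x - y|) & phi @` P = Q.

End Rhombi.

Record rhombic_lattice (R : realType) := RhombicLattice {
  faces : set (set R[i]) ;
  faces_rhombus : forall P, faces P -> exists z a b, rhombus_at P z a b ;
  faces_cover : \bigcup_(P in faces) P = setT ;
  faces_edge_to_edge : forall P Q, faces P -> faces Q -> P <> Q ->
    [\/ P `&` Q = set0,
        exists z, [/\ corner P z, corner Q z & P `&` Q = [set z]] |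
        exists z w, [/\ side P z w, side Q z w & P `&` Q = segment z w]] ;
  faces_congruent : forall P Q, faces P -> faces Q -> congruent P Q
}.

Section Lattice.
Context {R : realType}.
Variable L : rhombic_lattice R.

Definition vertices : set R[i] := [set z | exists2 P, faces L P & corner P z].

Definition adjacent (z w : R[i]) : Prop := exists2 P, faces L P & side P z w.

Definition directions : set R[i] :=
  [set e | exists z w, adjacent z w /\ e = w - z].

(* The vertex set as a type; functions on the lattice are functions on it. *)
Definition vertex : Type := vertices.

Implicit Types (x y : vertex) (p : seq vertex).

(* The path [x :: p] in the graph with edge relation [e], from [x] to [y]. *)
Definition path_to (e : R[i] -> R[i] -> Prop) x p y : Prop :=
  path (fun u v : vertex => `[< e (val u) (val v) >]) x p /\ last x p = y.

(* In a rhombus with corners [z], [z + a], [z + a + b], [z + b] the sides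
   [z, z + a] and [z + b, z + b + a] are opposite. *)
Definition is_track (F : int -> set R[i]) : Prop :=
  forall n : int,
    [/\ faces L (F n), F n <> F (n + 1) &
      exists z a b, [/\ rhombus_at (F n) z a b,
        side (F (n - 1)) z (z + a) &
        side (F (n + 1)) (z + b) (z + b + a)]].

Definition tie (F : int -> set R[i]) (z w : R[i]) : Prop :=
  exists n : int, side (F n) z w /\ side (F (n + 1)) z w.

Definition coherent (F F' : int -> set R[i]) : Prop :=
  forall z w z' w', tie F z w -> tie F' z' w' ->
    (w' - z') / (w - z) \is Num.real.

(* The side of the track [F] on which [x] lies: the connected component of [x]
   in the graph deprived of the ties of [F]. *)
Definition track_side (F : int -> set R[i]) x : set vertex :=
  [set y | exists p, path_to (fun z w => adjacent z w /\ ~ tie F z w) x p y].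

Definition track_in (F : int -> set R[i]) (X : set vertex) : Prop :=
  forall (n : int) y, corner (F n) (val y) -> X y.

Definition coherent_tracks_on_both_sides : Prop :=
  forall F, is_track F -> forall x, exists F',
    [/\ is_track F', coherent F F' & track_in F' (track_side F x)].

Definition lattice_S : set R[i] :=
  [set t | exists2 e, directions e & 2 + t * (1 - e) = 0].

(** Discrete analytic functions *)

Section DiscreteAnalytic.
Context {V : lmodType R[i]}.
Implicit Types f g h : vertex -> V.

Fixpoint path_int f x p : V :=
  if p is y :: q then
    (val y - val x) *: (2^-1 *: (f x + f y)) + path_int f y q
  else 0.

Definition DA f : Prop :=
  forall x p, path_to adjacent x p x -> path_int f x p = 0.

(* Meaningful for [DA f]: the common value of the integrals of [f] along the
   paths from [x] to [y]. *)
Definition dint f x y : V :=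
  xget 0 [set I | exists2 p, path_to adjacent x p y & I = path_int f x p].

(* [o] is the vertex 0. *)
Definition Zplus (o : vertex) f : vertex -> V :=
  fun z => 2^-1 *: (f o - f z) + dint f o z.

(* Meaningful for [DA g]. *)
Definition Zminus (o : vertex) g : vertex -> V :=
  xget 0 [set h | DA h /\ forall z, Zplus o h z = g z - g o].

End DiscreteAnalytic.

(* [G] is the function (I - zA)^{-\odot}; these conditions determine it. *)
Definition is_resolvent_DA (M : normedModType R[i]) (o : vertex) (A : M -> M)
    (G : vertex -> M -> M) : Prop :=
  [/\ forall z, bounded_op (G z),
      DA G,
      forall z, G z - (Zplus o G z \o A) = id &
      forall z, G z - (A \o Zplus o G z) = id].

(** Reproducing kernel Hilbert spaces *)

(* [H], embedded by [ev] as a space of [N]-valued functions on [X], is the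
   reproducing kernel Hilbert space with the operator-valued kernel [K]; these
   conditions determine the image of [ev] and the inner product carried over
   to it. *)
Definition is_rkhs (X : Type) (N : hilbertType R) (K : X -> X -> N -> N)
    (H : hilbertType R) (ev : {linear H -> (X -> N)}) : Prop :=
  injective ev /\
  forall (w : X) (n : N), exists2 k : H,
    ev k = (fun z => K z w n) & forall f : H, hdot f k = hdot (ev f w) n.

End Lattice.

(* Main.v *)
(* Write [Gamma m z = C (G z m)].  The reproducing kernel Hilbert space of
   [K z w = F z (F w)^*] is the range of [Gamma]: [k_(w, n) |-> (F w)^* n]
   preserves inner products, hence extends to an isometry [V : HK -> M] with
   [ev f = Gamma (V f)], and [U = V^*] satisfies [ev (U m) = Gamma m].  The
   equation of [G] gives [Gamma m - Gamma m 0 = Z_+ (Gamma (A m))], so that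
   [Z_- (Gamma m) = Gamma (A m)] and [Z_-] acts on [HK] as [U A V].  For [t] in
   [S(Lambda)] the inverse of [t - Z_-] is [U (t - A)^-1 V], because the kernel of
   [Gamma] is invariant under [(t - A)^-1]: otherwise [Z_-] would have a discrete
   analytic eigenfunction [g] with eigenvalue [t].

   Such a [g], and likewise a [g] with [Z_+ g = 0], satisfies on every edge a
   recurrence [b (e - d) g(w) = b (e + d) g(z)], [d = w - z], where [e] is a
   direction.  It forces [g(z) = 0] when [d = e] and propagates zeros along edges
   of direction other than [e] and [- e].  Hence [g = 0] as soon as every vertex
   is joined, by edges of direction other than [e] and [- e], to a vertex [y] with
   an edge from [y] to [y + e].  If a vertex [x] is not, following paths given by
   the hypothesis on tracks one finds two distinct tracks with ties parallel to
   [e] whose right ends are joined to [x] without crossing a tie; but the strip of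
   either track separates the plane, so each would lie to the right of the
   other. *)
Require Import Defs.
From mathcomp Require Import all_boot all_order all_algebra.
From mathcomp Require Import complex.
From mathcomp Require Import all_classical all_reals all_analysis.
From mathcomp Require Import ring lra.

Import Order.TTheory GRing.Theory Num.Theory.
Import numFieldNormedType.Exports.

Local Open Scope classical_set_scope.
Local Open Scope ring_scope.

Set Implicit Arguments.
Unset Strict Implicit.
Unset Printing Implicit Defensive.

Local Notation Re := complex.Re.
Local Notation Im := complex.Im.
Local Notation "x %:C" := (real_complex _ x) (format "x %:C").
(* mathcomp-analysis has another [adjacent], on sequences. *)
Local Notation adjacent := Defs.adjacent.

(** * Rhombi *)

Section Plane.
Context {R : realType}.
Implicit Types (a b v w z q : R[i]) (P Q : set R[i]).


(** With complex numbers read as plane vectors, [dotp] is the inner product and [crs] the signed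
    area of the spanned parallelogram. *)
Definition dotp a b : R := Re a * Re b + Im a * Im b.
Definition crs a b : R := Re a * Im b - Im a * Re b.

Lemma ReD a b : Re (a + b) = Re a + Re b. Proof. by case: a b => [? ?] []. Qed.
Lemma ImD a b : Im (a + b) = Im a + Im b. Proof. by case: a b => [? ?] []. Qed.
Lemma ReN a : Re (- a) = - Re a. Proof. by case: a. Qed.
Lemma ImN a : Im (- a) = - Im a. Proof. by case: a. Qed.
Lemma ReZ (s : R) a : Re (s%:C * a) = s * Re a.
Proof. by case: a => [x y] /=; rewrite mul0r subr0. Qed.
Lemma ImZ (s : R) a : Im (s%:C * a) = s * Im a.
Proof. by case: a => [x y] /=; rewrite mul0r addr0. Qed.
Definition cE := (ReD, ImD, ReN, ImN, ReZ, ImZ).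

Lemma complex_ext a b : Re a = Re b -> Im a = Im b -> a = b.
Proof. by case: a b => [? ?] [? ?] /= -> ->. Qed.

Lemma norm_eqP a b :
  `|a| = `|b| <-> Re a ^+ 2 + Im a ^+ 2 = Re b ^+ 2 + Im b ^+ 2.
Proof.
rewrite !normc_def; split=> [[/(congr1 (fun x => x ^+ 2))]|-> //].
by rewrite !sqr_sqrtr // addr_ge0 ?sqr_ge0.
Qed.

Lemma norm_eq1P a : `|a| = 1 <-> Re a ^+ 2 + Im a ^+ 2 = 1.
Proof. by rewrite -(normr1 R[i]) norm_eqP /= expr1n expr0n addr0. Qed.

Lemma unit_intervalP (s : R[i]) :
  0 <= s <= 1 <-> exists2 r : R, 0 <= r <= 1 & s = r%:C.
Proof.
split=> [/andP[s0 s1]|[r /andP[r0 r1] ->]]; last first.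
  by rewrite !lecE /= r0 r1 eqxx.
exists (Re s); first by move: s0 s1; rewrite !lecE /= => /andP[_ ->] /andP[_ ->].
by apply: complex_ext => //=; apply/ger0_Im.
Qed.

Lemma rhombusP z a b q : rhombus z a b q <->
  exists s t : R, [/\ 0 <= s <= 1, 0 <= t <= 1 & q = z + s%:C * a + t%:C * b].
Proof.
split=> [[s [t [/unit_intervalP[s' ? ->] /unit_intervalP[t' ? ->] ->]]]|].
  by exists s', t'.
move=> [s [t [s01 t01 ->]]]; exists s%:C, t%:C; split=> //; apply/unit_intervalP.
  by exists s.
by exists t.
Qed.

Lemma segmentP z w q : segment z w q <->
  exists2 s : R, 0 <= s <= 1 & q = z + s%:C * (w - z).
Proof.
split=> [[s /unit_intervalP[s' ? ->] ->]|[s s01 ->]]; first by exists s'.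
by exists s%:C => //; apply/unit_intervalP; exists s.
Qed.

(** Unit vectors satisfy [dotp a b ^+ 2 + crs a b ^+ 2 = 1], so a zero [crs] makes the inner product
    1 or -1, and then [a - b] or [a + b] has norm zero. *)
Lemma crs_nondeg a b :
  `|a| = 1 -> `|b| = 1 -> a != b -> a != - b -> crs a b != 0.
Proof.
case: a b => [x y] [x' y'] /norm_eq1P /= h1 /norm_eq1P /= h2 nab naNb.
apply/eqP; rewrite /crs /= => h.
have : (x - x') ^+ 2 + (y - y') ^+ 2 = 0 \/ (x + x') ^+ 2 + (y + y') ^+ 2 = 0.
  have : (x * x' + y * y' - 1) * (x * x' + y * y' + 1) = 0.
    have -> : (x * x' + y * y' - 1) * (x * x' + y * y' + 1) =
      (x ^+ 2 + y ^+ 2) * (x' ^+ 2 + y' ^+ 2) - 1 - (x * y' - y * x') ^+ 2 by ring.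
    by rewrite h1 h2 h; ring.
  by move=> /eqP; rewrite mulf_eq0 => /orP[/eqP e|/eqP e]; [left|right]; nra.
case=> /eqP; rewrite paddr_eq0 ?sqr_ge0 // !sqrf_eq0.
- rewrite !subr_eq0 => /andP[/eqP e1 /eqP e2].
  by move: nab; rewrite e1 e2 eqxx.
- rewrite !addr_eq0 => /andP[/eqP e1 /eqP e2].
  by move: naNb; rewrite e1 e2 eqxx.
Qed.

Lemma rhombus_at_crs P z a b : rhombus_at P z a b -> crs a b != 0.
Proof. by case=> *; apply: crs_nondeg. Qed.

(** Cramer's rule in the basis [a], [b]. *)
Lemma crs_decomp a b q : crs a b != 0 ->
  q = (crs q b / crs a b)%:C * a + (crs a q / crs a b)%:C * b.
Proof.
move=> h; apply: complex_ext; rewrite !cE; move: h; rewrite /crs => h; field; exact: h.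
Qed.

Lemma rhombus_crsP z a b q : crs a b != 0 -> rhombus z a b q <->
  0 <= crs (q - z) b / crs a b <= 1 /\ 0 <= crs a (q - z) / crs a b <= 1.
Proof.
move=> h; split=> [/rhombusP[s [t [s01 t01 ->]]]|[h1 h2]].
  have -> : crs (z + s%:C * a + t%:C * b - z) b = s * crs a b.
    by rewrite /crs !cE; ring.
  have -> : crs a (z + s%:C * a + t%:C * b - z) = t * crs a b.
    by rewrite /crs !cE; ring.
  by rewrite !mulfK.
apply/rhombusP; exists (crs (q - z) b / crs a b), (crs a (q - z) / crs a b).
split=> //; rewrite -addrA -(crs_decomp (q - z) h); ring.
Qed.

Lemma rhombus_swap z a b : rhombus z a b = rhombus z b a.
Proof.
apply/seteqP; split=> q [s [t [? ? ->]]]; exists t, s; split=> //; ring.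
Qed.

Lemma rhombus_flip z a b : rhombus z a b = rhombus (z + a) (- a) b.
Proof.
have h (x : R) : 0 <= x <= 1 -> 0 <= 1 - x <= 1 by move=> ?; lra.
apply/seteqP; split=> q /rhombusP[s [t [/h ? ? ->]]]; apply/rhombusP;
  exists (1 - s), t; split=> //; apply: complex_ext; rewrite !cE; ring.
Qed.

Lemma rhombus_at_swap P z a b : rhombus_at P z a b -> rhombus_at P z b a.
Proof.
case=> ? ? ab aNb ->; split=> //; first by rewrite eq_sym.
- by apply: contraNneq aNb => ->; rewrite opprK.
- exact: rhombus_swap.
Qed.

Lemma rhombus_at_flip P z a b : rhombus_at P z a b -> rhombus_at P (z + a) (- a) b.
Proof.
case=> ? ? ab aNb ->; split=> //; rewrite ?normrN //.
- by apply: contraNneq aNb => <-; rewrite opprK.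
- by rewrite eqr_opp.
- exact: rhombus_flip.
Qed.

Lemma rhombus_at_up P z a b : rhombus_at P z a b -> rhombus_at P (z + b) a (- b).
Proof. by move=> /rhombus_at_swap/rhombus_at_flip/rhombus_at_swap. Qed.

Lemma sideP P z a : side P z (z + a) <-> exists b, rhombus_at P z a b.
Proof. by rewrite /side (_ : z + a - z = a); last ring. Qed.

Lemma side_sym P z w : side P z w -> side P w z.
Proof.
move=> [b /rhombus_at_flip h]; exists b.
by move: h; rewrite opprB addrCA subrr addr0.
Qed.

(* Points of a side are extreme in every direction but its own. *)
Lemma side_support P z a b q v (s : R) : rhombus_at P z a b ->
  q = z + s%:C * a -> P (q + v) -> P (q - v) -> crs a v = 0.
Proof.
move=> h; have ab := rhombus_at_crs h; case: h => _ _ _ _ -> ->.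
move=> /(rhombus_crsP _ _ ab)[_ /andP[+ _]] /(rhombus_crsP _ _ ab)[_ /andP[+ _]].
have -> : crs a (z + s%:C * a + v - z) = crs a v by rewrite /crs !cE; ring.
have -> : crs a (z + s%:C * a - v - z) = - crs a v by rewrite /crs !cE; ring.
rewrite mulNr => h1 h2; have /eqP : crs a v / crs a b = 0 by lra.
by rewrite mulf_eq0 invr_eq0 (negbTE ab) orbF => /eqP.
Qed.

(** A corner lies on two sides, and being extreme across both makes [v] parallel to [a] and to
    [b]. *)
Lemma corner_support P q v : corner P q -> P (q + v) -> P (q - v) -> v = 0.
Proof.
move=> [a [b h]] h1 h2; have ab := rhombus_at_crs h.
have e : q = q + 0%:C * a by apply: complex_ext; rewrite !cE; ring.
have e' : q = q + 0%:C * b by apply: complex_ext; rewrite !cE; ring.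
have av := side_support h e h1 h2.
have bv := side_support (rhombus_at_swap h) e' h1 h2.
have vb : crs v b = 0 by rewrite -[RHS]oppr0 -bv /crs; ring.
by rewrite (crs_decomp v ab) av vb !mul0r; apply: complex_ext; rewrite !cE /=; ring.
Qed.

Lemma rhombus_at_move P p e b (s t : R) : rhombus_at P p e b -> 0 < s < 1 ->
  0 <= t <= 1 -> exists2 d : R, 0 < d &
  P (p + s%:C * e + t%:C * b + d%:C * e) /\ P (p + s%:C * e + t%:C * b - d%:C * e).
Proof.
move=> [_ _ _ _ ->] s01 t01; exists (Num.min s (1 - s)).
  by rewrite lt_min; lra.
have h : Num.min s (1 - s) <= s /\ Num.min s (1 - s) <= 1 - s /\ 0 <= Num.min s (1 - s).
  by rewrite !ge_min !lexx !le_min orbT; split=> //; split=> //; lra.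
split; apply/rhombusP; [exists (s + Num.min s (1 - s))|exists (s - Num.min s (1 - s))];
  exists t; (split=> //; [lra|apply: complex_ext; rewrite !cE; ring]).
Qed.

Lemma crsZ a b (d : R) : crs a (d%:C * b) = d * crs a b.
Proof. by rewrite /crs !cE; ring. Qed.

Lemma unit_parallel a b : `|a| = 1 -> `|b| = 1 -> crs a b = 0 -> b = a \/ b = - a.
Proof.
move=> a1 b1 h; have [->|ab] := eqVneq a b; first by left.
have [->|aNb] := eqVneq a (- b); first by right; rewrite opprK.
by have := crs_nondeg a1 b1 ab aNb; rewrite h eqxx.
Qed.

(** An interior point of the second side moves within [P] both ways along [a1], so [side_support]
    makes [a1] parallel to [a]. Both ends of the second side have [a]-coordinate in [0, 1], where a
    unit segment fits in only two ways. *)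
Lemma side_overlap P z a b z1 a1 b1 (s t : R) :
  rhombus_at P z a b -> rhombus_at P z1 a1 b1 -> 0 < t < 1 ->
  z + s%:C * a = z1 + t%:C * a1 ->
  (z1 = z /\ a1 = a) \/ (z1 = z + a /\ a1 = - a).
Proof.
move=> h h1 t01 e.
have z01 : 0 <= (0 : R) <= 1 by rewrite lexx ler01.
have [d d0 [q1 q2]] := rhombus_at_move h1 t01 z01.
have e0 : z1 + t%:C * a1 + 0%:C * b1 = z + s%:C * a.
  by rewrite e; apply: complex_ext; rewrite !cE; ring.
have := side_support h e0 q1 q2; rewrite crsZ => /eqP.
rewrite mulf_eq0 gt_eqF //= => /eqP aa1.
have ab := rhombus_at_crs h.
have Pz1 : P z1.
  case: h1 => _ _ _ _ ->; apply/rhombusP; exists 0, 0.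
  by split; [lra|lra|apply: complex_ext; rewrite !cE; ring].
have Pza1 : P (z1 + a1).
  case: h1 => _ _ _ _ ->; apply/rhombusP; exists 1, 0.
  by split; [lra|lra|apply: complex_ext; rewrite !cE; ring].
case: (h) => a_1 _ _ _ Pe; case: (h1) => a1_1 _ _ _ _.
move: Pz1 Pza1; rewrite Pe => /(rhombus_crsP _ _ ab)[+ _] /(rhombus_crsP _ _ ab)[+ _].
have -> : z1 = z + s%:C * a - t%:C * a1 by rewrite e addrK.
have [->|->] := unit_parallel a_1 a1_1 aa1.
  have -> : crs (z + s%:C * a - t%:C * a - z) b = (s - t) * crs a b.
    by rewrite /crs !cE; ring.
  have -> : crs (z + s%:C * a - t%:C * a + a - z) b = (s - t + 1) * crs a b.
    by rewrite /crs !cE; ring.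
  rewrite !mulfK // => ? ?; left; have -> : s = t by lra.
  by rewrite addrK.
have -> : crs (z + s%:C * a - t%:C * - a - z) b = (s + t) * crs a b.
  by rewrite /crs !cE; ring.
have -> : crs (z + s%:C * a - t%:C * - a - a - z) b = (s + t - 1) * crs a b.
  by rewrite /crs !cE; ring.
rewrite !mulfK // => ? ?; right; split=> //.
have -> : s = 1 - t by lra.
by apply: complex_ext; rewrite !cE; ring.
Qed.

(** For [t] equal to 0 or 1 the point is inside a side of direction [e], and [side_overlap] applies.
    For other [t] it is interior to [P], and extremality would make [w - z] parallel to both [e] and
    [b]. *)
Lemma side_meets_strip P p e b z w q (s t : R) :
  rhombus_at P p e b -> side P z w -> segment z w q ->
  q = p + s%:C * e + t%:C * b -> 0 < s < 1 -> 0 <= t <= 1 ->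
  exists2 c, c = p \/ c = p + b & (z = c /\ w = c + e) \/ (z = c + e /\ w = c).
Proof.
move=> h [b1 h1] /segmentP[r r01 qE] qE' s01 t01.
have fin c f : rhombus_at P c e f -> q = c + s%:C * e ->
    (z = c /\ w = c + e) \/ (z = c + e /\ w = c).
  move=> hc qc; have := side_overlap h1 hc s01 (etrans (esym qE) qc).
  case=> [[-> ->]|[-> ->]]; [left|right]; split; ring.
have [t0|tn0] := eqVneq t 0.
  exists p; first by left.
  by apply: (fin _ _ h); rewrite qE' t0; apply: complex_ext; rewrite !cE; ring.
have [t1|tn1] := eqVneq t 1.
  exists (p + b); first by right.
  apply: (fin _ _ (rhombus_at_up h)); rewrite qE' t1.
  by apply: complex_ext; rewrite !cE; ring.
have t01' : 0 < t < 1 by move: tn0 tn1; rewrite !neq_lt; lra.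
have [d d0 [q1 q2]] := rhombus_at_move h s01 t01.
have /(rhombus_at_move (rhombus_at_swap h) t01')[d' d'0] : 0 <= s <= 1 by lra.
rewrite (_ : p + t%:C * b + s%:C * e = p + s%:C * e + t%:C * b); last by ring.
move=> [q3 q4]; rewrite -qE' in q1 q2 q3 q4.
have /eqP := side_support h1 qE q1 q2; rewrite crsZ mulf_eq0 gt_eqF //= => /eqP c1.
have /eqP := side_support h1 qE q3 q4; rewrite crsZ mulf_eq0 gt_eqF //= => /eqP c2.
have wz : w - z = 0.
  rewrite (crs_decomp (w - z) (rhombus_at_crs h)) c2.
  have -> : crs e (w - z) = 0 by rewrite -[RHS]oppr0 -c1 /crs; ring.
  by rewrite !mul0r; apply: complex_ext; rewrite !cE /=; ring.
by move: (rhombus_at_crs h1); rewrite wz /crs /= !mul0r subr0 eqxx.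
Qed.

End Plane.

(** * Congruent unit rhombi have the same area *)

Section Congruence.
Context {R : realType}.
Implicit Types (a b v w z q : R[i]) (P Q : set R[i]).

Definition nsq z : R := Re z ^+ 2 + Im z ^+ 2.

Lemma nsq_le1 a : nsq a = 1 -> `|Re a| <= 1 /\ `|Im a| <= 1.
Proof. by rewrite /nsq => h; rewrite !ler_norml; split; apply/andP; split; nra. Qed.

Lemma crs_dotp a b : nsq a = 1 -> nsq b = 1 -> crs a b ^+ 2 = 1 - dotp a b ^+ 2.
Proof.
move=> h1 h2; have : nsq a * nsq b = 1 by rewrite h1 h2 mulr1.
by rewrite /nsq /crs /dotp; nra.
Qed.

Lemma rhombus_diameter P z a b x y : rhombus_at P z a b -> P x -> P y ->
  nsq (x - y) <= 2 + 2 * `|dotp a b|.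
Proof.
case=> /norm_eq1P a1 /norm_eq1P b1 _ _ ->.
move=> /rhombusP[s [t [s01 t01 ->]]] /rhombusP[s' [t' [s01' t01' ->]]].
have -> : nsq (z + s%:C * a + t%:C * b - (z + s'%:C * a + t'%:C * b)) =
  (s - s') ^+ 2 * (Re a ^+ 2 + Im a ^+ 2) + (t - t') ^+ 2 * (Re b ^+ 2 + Im b ^+ 2)
   + 2 * ((s - s') * (t - t')) * dotp a b.
  by rewrite /nsq /dotp !cE; ring.
rewrite a1 b1 !mulr1 -addrA; have h1 : (s - s') ^+ 2 <= 1 by nra.
have h2 : (t - t') ^+ 2 <= 1 by nra.
have h3 : `|(s - s') * (t - t')| <= 1.
  by rewrite normrM mulr_ile1 // ler_norml; apply/andP; split; lra.
have : (s - s') * (t - t') * dotp a b <= `|dotp a b|.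
  by rewrite (le_trans (ler_norm _)) // normrM ler_piMl.
by lra.
Qed.

Lemma rhombus_diameter_attained P z a b : rhombus_at P z a b ->
  exists x y, [/\ P x, P y & nsq (x - y) = 2 + 2 * `|dotp a b|].
Proof.
case=> /norm_eq1P a1 /norm_eq1P b1 _ _ ->.
have mem (s t : R) : 0 <= s <= 1 -> 0 <= t <= 1 ->
    rhombus z a b (z + s%:C * a + t%:C * b).
  by move=> ? ?; apply/rhombusP; exists s, t.
have i0 : 0 <= (0 : R) <= 1 by rewrite lexx ler01.
have i1 : 0 <= (1 : R) <= 1 by rewrite lexx ler01.
have [d0|d0] := leP 0 (dotp a b).
  exists (z + 1%:C * a + 1%:C * b), (z + 0%:C * a + 0%:C * b).
  split; [exact: mem|exact: mem|rewrite (ger0_norm d0) /nsq !cE].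
  by move: a1 b1; rewrite /dotp; lra.
exists (z + 1%:C * a + 0%:C * b), (z + 0%:C * a + 1%:C * b).
split; [exact: mem|exact: mem|rewrite (ltr0_norm d0) /nsq !cE /dotp].
by move: a1 b1; lra.
Qed.

(** An isometry preserves the diameter, whose square is [2 + 2 * |dotp a b|] for a unit rhombus, and
    [dotp] determines [crs] up to sign. *)
Lemma congruent_crs P Q z a b z' a' b' : congruent P Q ->
  rhombus_at P z a b -> rhombus_at Q z' a' b' -> `|crs a b| = `|crs a' b'|.
Proof.
move=> [phi iso PQ] hP hQ.
have nphi x y : nsq (phi x - phi y) = nsq (x - y) by apply/norm_eqP.
have dd : `|dotp a b| = `|dotp a' b'|.
  apply/eqP; rewrite eq_le; apply/andP; split.
  - have [x [y [Px Py e]]] := rhombus_diameter_attained hP.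
    have Qx : Q (phi x) by rewrite -PQ; exists x.
    have Qy : Q (phi y) by rewrite -PQ; exists y.
    by have := rhombus_diameter hQ Qx Qy; rewrite nphi e; lra.
  - have [x [y [+ + e]]] := rhombus_diameter_attained hQ.
    rewrite -PQ => -[x' Px xE] [y' Py yE].
    by have := rhombus_diameter hP Px Py; rewrite -nphi xE yE e; lra.
case: hP hQ => /norm_eq1P a1 /norm_eq1P b1 _ _ _ [/norm_eq1P a1' /norm_eq1P b1' _ _ _].
apply/eqP; rewrite -(eqrXn2 (_ : 0 < 2)%N) // !real_normK ?num_real //.
by rewrite !crs_dotp // -[dotp a b ^+ 2]real_normK ?num_real // dd real_normK ?num_real.
Qed.

End Congruence.

(** * Separation of faces, and the face on the other side of an edge *)

Section Faces.
Context {R : realType}.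
Variable L : rhombic_lattice R.
Implicit Types (a b v w z q : R[i]) (P Q : set R[i]).

(** As the sides have length 1, the common area of the faces is also the distance between opposite
    sides. *)
Lemma face_height : exists2 h : R, 0 < h &
  forall P z a b, faces L P -> rhombus_at P z a b -> `|crs a b| = h.
Proof.
have : (\bigcup_(P in faces L) P) 0 by rewrite faces_cover.
move=> [P LP _]; have [z [a [b hP]]] := faces_rhombus LP.
exists `|crs a b|; first by rewrite normr_gt0 (rhombus_at_crs hP).
by move=> Q z' a' b' LQ hQ; apply: (congruent_crs (faces_congruent LQ LP) hQ hP).
Qed.

Lemma segment_crs z w q : segment z w q -> crs (w - z) (q - z) = 0.
Proof. by move=> /segmentP[s _ ->]; rewrite /crs !cE; ring. Qed.

(** Distinct faces meet at most in a segment, which cannot contain three points off a line. *)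
Lemma faces_meet_triangle P Q q (d : R) : faces L P -> faces L Q -> 0 < d ->
  (P `&` Q) q -> (P `&` Q) (q + Complex d 0) -> (P `&` Q) (q + Complex 0 d) -> P = Q.
Proof.
move=> LP LQ d0 h1 h2 h3; apply: contrapT => PQ.
have dn0 : d != 0 by rewrite gt_eqF.
case: (faces_edge_to_edge LP LQ PQ) => [e|[z [_ _ e]]|[z [w [sP _ e]]]].
- by move: h1; rewrite e.
- move: h1 h2; rewrite e => -> /= /eqP; rewrite -subr_eq0 addrAC subrr add0r.
  by rewrite eq_complex /= (negbTE dn0).
- move: h1 h2 h3; rewrite e => /segment_crs h1 /segment_crs h2 /segment_crs h3.
  case: sP => b /rhombus_at_crs; apply/negP; rewrite negbK.
  have /eqP : d * Re (w - z) = 0 by move: h1 h3; rewrite /crs !cE /=; lra.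
  rewrite mulf_eq0 (negbTE dn0) /= => /eqP r0.
  have /eqP : d * Im (w - z) = 0 by move: h1 h2; rewrite /crs !cE /=; lra.
  rewrite mulf_eq0 (negbTE dn0) /= => /eqP i0.
  by rewrite /crs r0 i0 !mul0r subr0.
Qed.

Definition center z a b := z + 2^-1%:C * a + 2^-1%:C * b.

(** The size of the square depends on the height alone: with unit sides, [crs v b] and [crs a v] are
    at most [h / 2] in absolute value, which is half of [crs a b]. *)
Lemma face_around_center P z a b (h : R) v : rhombus_at P z a b ->
  0 < h -> `|crs a b| = h -> `|Re v| <= h / 4 -> `|Im v| <= h / 4 ->
  P (center z a b + v).
Proof.
move=> hP h0 hE v1 v2; have ab := rhombus_at_crs hP.
case: hP => /norm_eq1P /nsq_le1[a1 a2] /norm_eq1P /nsq_le1[b1 b2] _ _ ->.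
apply/rhombus_crsP => //.
have -> : crs (center z a b + v - z) b = 2^-1 * crs a b + crs v b.
  by rewrite /center /crs !cE; ring.
have -> : crs a (center z a b + v - z) = 2^-1 * crs a b + crs a v.
  by rewrite /center /crs !cE; ring.
have bound (x : R) : `|x| <= h / 2 -> 0 <= (2^-1 * crs a b + x) / crs a b <= 1.
  move=> xh; rewrite mulrDl mulfK //.
  have : `|x / crs a b| <= 2^-1.
    by rewrite normrM normfV hE ler_pdivrMr //; lra.
  by rewrite ler_norml; lra.
have prod (x y x' y' : R) : `|x| <= h / 4 -> `|y| <= h / 4 -> `|x'| <= 1 -> `|y'| <= 1 ->
    `|x * y' - y * x'| <= h / 2.
  move=> ? ? ? ?; rewrite (le_trans (ler_normB _ _)) // !normrM.
  have ? : `|x| * `|y'| <= h / 4 by rewrite -[leRHS]mulr1 ler_pM.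
  have ? : `|y| * `|x'| <= h / 4 by rewrite -[leRHS]mulr1 ler_pM.
  by lra.
split; apply: bound; first exact: prod.
by rewrite /crs distrC mulrC [X in _ - X]mulrC; apply: prod.
Qed.

(** Both faces contain a small square around the second center, hence a triangle. This is the
    uniform separation of centers. *)
Lemma faces_near P Q z a b z' a' b' (h : R) : faces L P -> faces L Q ->
  rhombus_at P z a b -> rhombus_at Q z' a' b' -> 0 < h ->
  `|crs a b| = h -> `|crs a' b'| = h ->
  `|Re (center z' a' b' - center z a b)| <= h / 8 ->
  `|Im (center z' a' b' - center z a b)| <= h / 8 -> P = Q.
Proof.
move=> LP LQ hP hQ h0 Ph Qh d1 d2.
have inQ v : `|Re v| <= h / 8 -> `|Im v| <= h / 8 -> Q (center z' a' b' + v).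
  by move=> ? ?; apply: (face_around_center hQ h0 Qh); lra.
have inP v : `|Re v| <= h / 8 -> `|Im v| <= h / 8 -> P (center z' a' b' + v).
  move=> v1 v2; have -> : center z' a' b' + v =
    center z a b + (center z' a' b' - center z a b + v) by ring.
  by apply: (face_around_center hP h0 Ph); rewrite (ReD, ImD);
    rewrite (le_trans (ler_normD _ _)) //; lra.
have in2 v : `|Re v| <= h / 8 -> `|Im v| <= h / 8 -> (P `&` Q) (center z' a' b' + v).
  by move=> ? ?; split; [apply: inP|apply: inQ].
have h8 : 0 <= h / 8 by lra.
apply: (@faces_meet_triangle _ _ (center z' a' b') (h / 8)) => //; first by lra.
- by rewrite -[center _ _ _]addr0; apply: in2; rewrite /= normr0.
- by apply: in2; rewrite /= ?normr0 // ger0_norm.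
- by apply: in2; rewrite /= ?normr0 // ger0_norm.
Qed.

(** If each value were avoided from some index [N t] on, [f] would have no value at the largest of
    these indices. *)
Lemma infinite_pigeonhole (T : finType) (f : nat -> T) :
  exists t, forall n, exists2 k, (n <= k)%N & f k = t.
Proof.
apply: contrapT => /forallNP h.
have {}h t : exists n, forall k, (n <= k)%N -> f k != t.
  have /existsNP[n hn] := h t; exists n => k nk; apply/eqP => e.
  by apply: hn; exists k.
pose N t := xget 0%N [set n | forall k, (n <= k)%N -> f k != t].
have hN t k : (N t <= k)%N -> f k != t.
  by rewrite /N; case: xgetP => [n _ +|]; [apply|have [n hn /(_ n)] := h t].
have /negP := hN (f (\max_t N t)%N) _ (leq_bigmax (f (\max_t N t)%N)).
by apply.
Qed.

Lemma grid_pigeonhole (u : nat -> R[i]) (m : R[i]) (r d : R) : 0 < d ->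
  (forall k, `|Re (u k - m)| <= r /\ `|Im (u k - m)| <= r) ->
  exists k0, forall n, exists2 k, (n <= k)%N &
    `|Re (u k - u k0)| <= d /\ `|Im (u k - u k0)| <= d.
Proof.
move=> d0 ur; have r0 : 0 <= r by apply: le_trans (ur 0).1.
(* Each coordinate range, of length [r + r], is cut into cells of width [d], numbered below [B]. *)
pose B := (Num.truncn ((r + r) / d)).+1.
pose cell (x : R) : 'I_B := inord (Num.truncn ((x + r) / d)).
have cellP x y : `|x| <= r -> `|y| <= r -> cell x = cell y -> `|x - y| <= d.
  move=> xr yr /(congr1 val).
  have nonneg (t : R) : `|t| <= r -> 0 <= (t + r) / d.
    by rewrite ler_norml => ?; rewrite divr_ge0 //; lra.
  have small (t : R) : `|t| <= r -> (Num.truncn ((t + r) / d) < B)%N.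
    rewrite ler_norml => /andP[_ tr]; rewrite ltnS; apply: le_truncn.
    by rewrite ler_pM2r ?invr_gt0 //; lra.
  rewrite /cell /= !inordK ?small // => e.
  have := truncn_itv (nonneg _ xr); have := truncn_itv (nonneg _ yr).
  rewrite e -(natr1 (Num.truncn _)); set k := (_ %:R) => ? ?.
  have : `|(x + r) / d - (y + r) / d| <= 1 by rewrite ler_norml; lra.
  rewrite -mulrBl normrM normfV (gtr0_norm d0) ler_pdivrMr // mul1r.
  by rewrite opprD addrACA subrr addr0.
pose f k := (cell (Re (u k - m)), cell (Im (u k - m))).
have [t ft] := infinite_pigeonhole f.
have [k0 _ fk0] := ft 0%N; exists k0 => n.
have [k nk fk] := ft n; exists k => //.
have e : u k - u k0 = (u k - m) - (u k0 - m) by ring.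
move: fk; rewrite -fk0 => -[c1 c2].
have [a1 a2] := ur k; have [b1 b2] := ur k0.
by rewrite e ReD ImD ReN ImN; split; apply: cellP.
Qed.

Lemma affine_limit_ge0 (x y : R) :
  (forall n, exists2 k, (n <= k)%N & 0 <= x + k.+1%:R^-1 * y) -> 0 <= x.
Proof.
move=> h; rewrite leNgt; apply/negP => x0.
have [k nk] := h (Num.truncn (`|y| / - x)).
apply/negP; rewrite -ltNge.
have : `|y| / - x < k.+1%:R.
  by apply: lt_le_trans (truncnS_gt _) _; rewrite ler_nat ltnS.
rewrite ltr_pdivrMr ?oppr_gt0 // mulrC -ltr_pdivrMr ?ltr0n // => hy.
have : k.+1%:R^-1 * y <= `|y| / k.+1%:R.
  by rewrite mulrC ler_pM2r ?invr_gt0 ?ltr0n // ler_norm.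
by move: hy; set u := _ / _; set v := _ * y => ? ?; lra.
Qed.

Lemma affine_limit_unit (x y : R) :
  (forall n, exists2 k, (n <= k)%N & 0 <= x + k.+1%:R^-1 * y <= 1) -> 0 <= x <= 1.
Proof.
move=> h; apply/andP; split.
  by apply: (@affine_limit_ge0 _ y) => n; have [k nk /andP[? ?]] := h n; exists k.
rewrite -subr_ge0; apply: (@affine_limit_ge0 _ (- y)) => n.
have [k nk b] := h n; exists k => //.
by rewrite mulrN; move: b; set v := _ * y => ?; lra.
Qed.

Lemma rhombus_closed_ray P z a b m v : rhombus_at P z a b ->
  (forall n, exists2 k, (n <= k)%N & P (m + (k.+1%:R^-1)%:C * v)) -> P m.
Proof.
move=> hP h; have ab := rhombus_at_crs hP; case: hP => _ _ _ _ PE.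
have e1 (r : R) : crs (m + r%:C * v - z) b / crs a b
    = crs (m - z) b / crs a b + r * (crs v b / crs a b).
  by rewrite mulrA -mulrDl; congr (_ / _); rewrite /crs !cE; ring.
have e2 (r : R) : crs a (m + r%:C * v - z) / crs a b
    = crs a (m - z) / crs a b + r * (crs a v / crs a b).
  by rewrite mulrA -mulrDl; congr (_ / _); rewrite /crs !cE; ring.
rewrite PE; apply/rhombus_crsP => //; split.
  apply: (@affine_limit_unit _ (crs v b / crs a b)) => n.
  have [k nk +] := h n; rewrite PE => /(rhombus_crsP _ _ ab)[]; rewrite e1 => ? _.
  by exists k.
apply: (@affine_limit_unit _ (crs a v / crs a b)) => n.
have [k nk +] := h n; rewrite PE => /(rhombus_crsP _ _ ab)[_]; rewrite e2 => ?.
by exists k.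
Qed.

Lemma center_near P z a b q : rhombus_at P z a b -> P q ->
  `|Re (center z a b - q)| <= 1 /\ `|Im (center z a b - q)| <= 1.
Proof.
case=> /norm_eq1P /nsq_le1[a1 a2] /norm_eq1P /nsq_le1[b1 b2] _ _ ->.
move=> /rhombusP[s [t [s01 t01 ->]]].
have e : center z a b - (z + s%:C * a + t%:C * b) =
   (2^-1 - s)%:C * a + (2^-1 - t)%:C * b.
  by rewrite /center; apply: complex_ext; rewrite !cE; ring.
have half (s' x : R) : 0 <= s' <= 1 -> `|x| <= 1 -> `|(2^-1 - s') * x| <= 2^-1.
  move=> ? ?; rewrite normrM -[leRHS]mulr1 ler_pM //.
  by rewrite ler_norml; lra.
rewrite e !cE; split; rewrite (le_trans (ler_normD _ _)) //.
  by have := half _ _ s01 a1; have := half _ _ t01 b1; lra.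
by have := half _ _ s01 a2; have := half _ _ t01 b2; lra.
Qed.

(* Centers of distinct faces are uniformly separated, so only finitely many faces
   come near [m], and one of them contains infinitely many points of the ray. *)
Lemma face_at_end_of_ray m v : exists Q, [/\ faces L Q, Q m &
  exists k : nat, Q (m + (k.+1%:R^-1)%:C * v)].
Proof.
have [h h0 hE] := face_height.
pose q k := m + (k.+1%:R^-1)%:C * v.
have /choice[Q hQ] k : exists Q, faces L Q /\ Q (q k).
  have : (\bigcup_(P in faces L) P) (q k) by rewrite faces_cover.
  by move=> [P ? ?]; exists P.
have /choice[f hf] k : exists zab : R[i] * R[i] * R[i],
    rhombus_at (Q k) zab.1.1 zab.1.2 zab.2.
  by have [z [a [b ?]]] := faces_rhombus (hQ k).1; exists (z, a, b).
pose c k := center (f k).1.1 (f k).1.2 (f k).2.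
pose r := 1 + `|Re v| + `|Im v|.
have h8 : 0 < h / 8 by lra.
have cr k : `|Re (c k - m)| <= r /\ `|Im (c k - m)| <= r.
  have -> : c k - m = (c k - q k) + (k.+1%:R^-1)%:C * v by rewrite /q; ring.
  have [c1 c2] := center_near (hf k) (hQ k).2.
  have small (x : R) : `|k.+1%:R^-1 * x| <= `|x|.
    by rewrite normrM ler_piMl // normfV normr_nat invf_le1 ?ltr0n // ler1n.
  rewrite !cE in c1 c2 *.
  split; rewrite (le_trans (ler_normD _ _)) //.
    by have := small (Re v); have := normr_ge0 (Im v); rewrite /r; lra.
  by have := small (Im v); have := normr_ge0 (Re v); rewrite /r; lra.
have [k0 near_k0] := grid_pigeonhole h8 cr.
exists (Q k0); split; [exact: (hQ k0).1| |by exists k0; exact: (hQ k0).2].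
apply: (rhombus_closed_ray (hf k0) (v := v)) => n.
have [k nk [c1 c2]] := near_k0 n; exists k => //.
have -> : Q k0 = Q k.
  exact: (faces_near (hQ k0).1 (hQ k).1 (hf k0) (hf k) h0
    (hE _ _ _ _ (hQ k0).1 (hf k0)) (hE _ _ _ _ (hQ k).1 (hf k)) c1 c2).
exact: (hQ k).2.
Qed.

(** The midpoint [m] of the side lies in a face [Q] that also has points beyond the side, so [Q]
    differs from [P]. As [m] is no corner of [P], edge-to-edge contact makes the whole side common.
    If [Q] lay on the same side of the line as [P], the two would share a point off that line. *)
Lemma face_across P z a b : faces L P -> rhombus_at P z a b ->
  exists Q b', [/\ faces L Q, rhombus_at Q z a b' & crs a b * crs a b' < 0].
Proof.
move=> LP hP; have ab := rhombus_at_crs hP.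
pose m := z + 2^-1%:C * a.
have half01 : 0 < (2^-1 : R) < 1 by lra.
have Pm : P m.
  case: hP => _ _ _ _ ->; apply/rhombusP; exists 2^-1, 0.
  by split; [lra|rewrite lexx ler01|rewrite /m; apply: complex_ext; rewrite !cE; ring].
have [Q [LQ Qm [k Qk]]] := face_at_end_of_ray m (- b).
have PQ : P <> Q.
  move=> PQ; move: Qk; rewrite -PQ; case: (hP) => _ _ _ _ ->.
  move=> /(rhombus_crsP _ _ ab)[_ /andP[+ _]].
  have -> : crs a (m + (k.+1%:R^-1)%:C * - b - z) = - k.+1%:R^-1 * crs a b.
    by rewrite /m /crs !cE; ring.
  by rewrite mulfK // oppr_ge0 leNgt invr_gt0 ltr0n.
have PQm : (P `&` Q) m by [].
have [b' hQ PQE] : exists2 b', rhombus_at Q z a b' & P `&` Q `<=` segment z (z + a).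
  case: (faces_edge_to_edge LP LQ PQ) => [e|[z1 [cz _ e]]|[z1 [w1 [[b1 sP] [b1' sQ] e]]]].
  - by move: PQm; rewrite e.
  - move: PQm cz; rewrite e => <- cm.
    have half0 : 0 <= (0 : R) <= 1 by rewrite lexx ler01.
    have [d d0 [m1 m2]] := rhombus_at_move hP half01 half0.
    have em : z + 2^-1%:C * a + 0%:C * b = m.
      by rewrite /m; apply: complex_ext; rewrite !cE; ring.
    rewrite em in m1 m2; have := corner_support cm m1 m2.
    move=> a0; move: ab; have := crsZ b a d; rewrite a0.
    rewrite (_ : crs b 0 = 0) => [/esym/eqP|]; last by rewrite /crs !mulr0 subr0.
    rewrite mulf_eq0 gt_eqF //= => /eqP ba.
    have -> : crs a b = - crs b a by rewrite /crs; ring.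
    by rewrite ba oppr0 eqxx.
  - move: (PQm); rewrite e => /segmentP[s s01 mE].
    have := side_overlap sP hP half01 (esym mE).
    case=> [[zE aE]|[zE aE]].
      exists b1'; first by rewrite zE aE.
      by rewrite zE aE addrC subrK.
    exists b1'; first by rewrite zE aE; apply: rhombus_at_flip.
    rewrite zE aE addrC subrK => x /segmentP[t t01 ->].
    apply/segmentP; exists (1 - t); first by lra.
    by apply: complex_ext; rewrite !cE; ring.
exists Q, b'; split=> //; rewrite ltNge; apply/negP => pos.
have ab' := rhombus_at_crs hQ.
have [h h0 hE] := face_height.
have eab : crs a b' = crs a b.
  have := hE _ _ _ _ LP hP; have := hE _ _ _ _ LQ hQ => <-.
  move=> /eqP; rewrite eqr_norm2 => /orP[/eqP //|/eqP e].
  by move: pos; rewrite e mulNr oppr_ge0 leNgt -expr2 exprn_even_gt0 // ab'.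
(* With this [d] the point [m + d b] is in both faces: the shear between [b] and [b'] changes the
   [a]-coordinate in [Q], which is 1/2 at [m], by at most [d / h = 1/2]. *)
pose d := h / 2.
have unit_crs : `|crs b b'| <= 1.
  case: (hP) (hQ) => _ /norm_eq1P b1 _ _ _ [_ /norm_eq1P b1' _ _ _].
  rewrite -(expr_le1 (_ : 0 < 2)%N) // real_normK ?num_real // crs_dotp //.
  by have := sqr_ge0 (dotp b b'); lra.
have h1 : h <= 1.
  case: (hP) => /norm_eq1P a1 /norm_eq1P b1 _ _ _.
  rewrite -(hE _ _ _ _ LP hP) -(expr_le1 (_ : 0 < 2)%N) // real_normK ?num_real // crs_dotp //.
  by have := sqr_ge0 (dotp a b); lra.
have Pd : P (m + d%:C * b).
  case: (hP) => _ _ _ _ ->; apply/rhombusP; exists 2^-1, d; split=> //; first by lra.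
  by rewrite /d; lra.
have Qd : Q (m + d%:C * b).
  case: (hQ) => _ _ _ _ ->; apply/rhombus_crsP => //.
  have -> : crs (m + d%:C * b - z) b' = 2^-1 * crs a b' + d * crs b b'.
    by rewrite /m /crs !cE; ring.
  have -> : crs a (m + d%:C * b - z) = d * crs a b by rewrite /m /crs !cE; ring.
  rewrite mulrDl -eab !mulfK //; split; last by rewrite /d; lra.
  have : `|d * crs b b' / crs a b'| <= 2^-1.
    rewrite normrM normfV (hE _ _ _ _ LQ hQ) ler_pdivrMr // normrM gtr0_norm /d; last by lra.
    by rewrite [leRHS]mulrC ler_piMr //; lra.
  by rewrite ler_norml; lra.
have /PQE/segment_crs : (P `&` Q) (m + d%:C * b) by [].
rewrite (_ : crs _ _ = d * crs a b); last by rewrite /m /crs !cE; ring.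
by move=> /eqP; rewrite mulf_eq0 (negbTE ab) orbF /d; apply/negP; lra.
Qed.

End Faces.

(** * Tracks *)

Section Tracks.
Context {R : realType}.
Variable L : rhombic_lattice R.
Implicit Types (e a b v w z q : R[i]) (P Q : set R[i]).

Lemma adjacent_sym z w : adjacent L z w -> adjacent L w z.
Proof. by move=> [P LP /side_sym ?]; exists P. Qed.

Lemma adjacent_vertex z w : adjacent L z w -> vertices L z.
Proof. by move=> [P LP [b h]]; exists P => //; exists (w - z), b. Qed.

(* The corners [p n], [p n + e] of the [n]-th face are the ends of a tie. *)
Definition track_data e (h : R) (p b : int -> R[i]) := forall n,
  [/\ faces L (rhombus (p n) e (b n)),
      rhombus_at (rhombus (p n) e (b n)) (p n) e (b n),
      p (n + 1) = p n + b n & crs e (b n) = h].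

Definition track_of e (p b : int -> R[i]) (n : int) := rhombus (p n) e (b n).

(** Faces are crossed from tie to tie with [face_across], upwards and downwards. The invariant [ok]
    fixes the orientation of each face, so that every step gains the same height [h]. *)
Lemma track_through z e : adjacent L z (z + e) ->
  exists (h : R) (p b : int -> R[i]), [/\ 0 < h, track_data e h p b & p 0 = z].
Proof.
move=> [P LP /sideP[b0 hP]].
have [h h0 hE] := face_height L.
pose ok (s : R[i] * R[i]) := [/\ faces L (rhombus s.1 e s.2),
  rhombus_at (rhombus s.1 e s.2) s.1 e s.2 & crs e s.2 = h].
have okI Q z' b : faces L Q -> rhombus_at Q z' e b -> 0 < crs e b -> ok (z', b).
  move=> LQ hQ pos; have := hE _ _ _ _ LQ hQ; rewrite (gtr0_norm pos) => ?.
  by case: (hQ) => _ _ _ _ QE; rewrite QE in LQ hQ.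
have /choice[U hU] s : exists b', ok s -> ok (s.1 + s.2, b').
  have [[L1 h1 c1]|ns] := pselect (ok s); last by exists 0 => /ns.
  have [Q [b [LQ hQ]]] := face_across L1 (rhombus_at_up h1).
  have -> : crs e (- s.2) = - h by rewrite -c1 /crs !cE; ring.
  by rewrite nmulr_rlt0 ?oppr_lt0 // => cb; exists b => _; apply: okI hQ cb.
have /choice[D hD] s : exists b', ok s -> ok (s.1 - b', b').
  have [[L1 h1 c1]|ns] := pselect (ok s); last by exists 0 => /ns.
  have [Q [b [LQ hQ]]] := face_across L1 h1.
  rewrite pmulr_rlt0 ?c1 // => cb; exists (- b) => _; apply: (okI Q) => //.
    by rewrite opprK; apply: rhombus_at_up.
  by move: cb; rewrite /crs !cE; lra.
(* The face numbered 0 must lie on the positive side of the edge: it is [P] or the face across. *)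
have [b1 ok1] : exists b1, ok (z, b1).
  have /orP[pos|neg] : (0 < crs e b0) || (crs e b0 < 0).
    by rewrite -neq_lt eq_sym (rhombus_at_crs hP).
    by exists b0; apply: okI hP pos.
  have [Q [b [LQ hQ]]] := face_across LP hP.
  by rewrite nmulr_rlt0 // => cb; exists b; apply: okI hQ cb.
pose up s := (s.1 + s.2, U s); pose dn s := (s.1 - D s, D s).
(* [Negz k] stands for [- (k + 1)]. *)
pose x (n : int) := match n with
  Posz k => iter k up (z, b1) | Negz k => iter k.+1 dn (z, b1) end.
have okx n : ok (x n).
  case: n => n; last by rewrite /x; elim: n.+1 => [//|k]; exact: hD.
  by rewrite /x; elim: n => [//|k]; exact: hU.
exists h, (fun n => (x n).1), (fun n => (x n).2); split=> // n.
have [k1 k2 k3] := okx n; split=> //; clear k1 k2 k3.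
case: n => [n|[|n]] //.
- by rewrite -PoszD addn1.
- by rewrite /= subrK.
- rewrite (_ : Negz n.+1 + 1 = Negz n); last by rewrite !NegzE -addn1 PoszD; ring.
  by rewrite [in RHS]/= subrK.
Qed.

(** * The strip covered by a track, and its two sides *)

Section Track.
Variables (e : R[i]) (h : R) (p b : int -> R[i]).
Hypotheses (h0 : 0 < h) (T : track_data e h p b).

Let hn0 : h != 0. Proof. by rewrite gt_eqF. Qed.

Lemma unit_dir : `|e| = 1. Proof. by have [_ [? _ _ _ _] _ _] := T 0. Qed.

Lemma dotp_ee : dotp e e = 1.
Proof. by have /norm_eq1P := unit_dir; rewrite /dotp !expr2. Qed.

Lemma crs_ee : crs e e = 0.
Proof. by rewrite /crs; ring. Qed.

(** Height over the base tie in units of the tie spacing, so that the [n]-th tie lies at level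
    [n]. *)
Definition level q : R := crs e (q - p 0) / h.

Lemma level_affine q v (s : R) : level (q + s%:C * v) = level q + s * (crs e v / h).
Proof. by rewrite /level /crs !cE; field. Qed.

Lemma levelD q v : level (q + v) = level q + crs e v / h.
Proof. by rewrite /level /crs !cE; field. Qed.

Lemma level_tie n : level (p n) = n%:~R.
Proof.
have S m : level (p (m + 1)) = level (p m) + 1.
  by have [_ _ -> c] := T m; rewrite levelD c divff.
have L0 : level (p 0) = 0 by rewrite /level /crs subrr /= !mulr0 subrr mul0r.
case: n => n.
  elim: n => // n IH; rewrite -addn1 PoszD S IH.
  by rewrite -[in RHS]pmulrn natrD.
elim: n => [|n IH].
  have := S (Negz 0); rewrite (_ : Negz 0 + 1 = 0) // L0 NegzE mulrNz => ?.
  by rewrite -pmulrn; lra.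
have := S (Negz n.+1).
rewrite (_ : Negz n.+1 + 1 = Negz n); last by rewrite !NegzE -addn1 PoszD; ring.
by rewrite IH !NegzE !mulrNz -!pmulrn -(natr1 n.+1) => ?; lra.
Qed.

(* Horizontal coordinate, in the frame with first axis [e], of the left
   boundary of the strip covered by the track, at the height of [q]. *)
Definition left_bound q : R :=
  let n := Num.floor (level q) in
  dotp e (p n) + (level q - n%:~R) * dotp e (b n).

(** At the upper end the floor jumps to [n + 1], but the two formulas agree there since
    [p (n + 1) = p n + b n]: the left boundary is continuous. *)
Lemma left_bound_piece n q : n%:~R <= level q <= n%:~R + 1 ->
  left_bound q = dotp e (p n) + (level q - n%:~R) * dotp e (b n).
Proof.
move=> /andP[n1]; rewrite le_eqVlt => /orP[/eqP n2|n2]; last first.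
  by rewrite /left_bound (@floor_def _ _ n) // n1 intrD.
rewrite /left_bound (@floor_def _ _ (n + 1)); last first.
  by rewrite n2 !intrD lexx /=; lra.
rewrite n2 intrD; have [_ _ -> _] := T n.
by rewrite /dotp !cE; ring.
Qed.

Lemma left_bound_level q q' : level q = level q' -> left_bound q = left_bound q'.
Proof. by rewrite /left_bound => ->. Qed.

Lemma left_bound_tie n (t : R) : 0 <= t <= 1 ->
  left_bound (p n + t%:C * b n) = dotp e (p n + t%:C * b n).
Proof.
have [_ _ _ c] := T n.
have l : level (p n + t%:C * b n) = n%:~R + t.
  by rewrite level_affine level_tie c divff // mulr1.
move=> t01; rewrite (@left_bound_piece n) l; last by lra.
by rewrite /dotp !cE; ring.
Qed.

Lemma crs_level q q' : crs e q = crs e q' <-> level q = level q'.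
Proof.
rewrite /level; split=> [E|/(mulIf (_ : h^-1 != 0))]; last first.
  by rewrite invr_eq0 => /(_ hn0); rewrite /crs !cE; lra.
by congr (_ / _); move: E; rewrite /crs !cE; lra.
Qed.

(** Horizontal position relative to the left boundary; as [e] is a unit vector, the strip is where
    it lies between 0 and 1. *)
Definition offset q := dotp e q - left_bound q.

Lemma offset_shift q (s : R) : offset (q + s%:C * e) = offset q + s.
Proof.
have E : left_bound (q + s%:C * e) = left_bound q.
  by apply: left_bound_level; rewrite level_affine crs_ee mul0r mulr0 addr0.
rewrite /offset E (_ : dotp e (q + s%:C * e) = dotp e q + s * dotp e e).
  by rewrite dotp_ee; ring.
by rewrite /dotp !cE; ring.
Qed.

Lemma offset_face n (t : R) : 0 <= t <= 1 -> offset (p n + t%:C * b n) = 0.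
Proof. by move=> t01; rewrite /offset left_bound_tie // subrr. Qed.

Lemma offset_tie n : offset (p n) = 0.
Proof.
rewrite -(@offset_face n 0) ?lexx ?ler01 //; congr offset.
by apply: complex_ext; rewrite !cE; ring.
Qed.

Lemma in_strip q : 0 < offset q < 1 ->
  exists n (s t : R), [/\ q = p n + s%:C * e + t%:C * b n, 0 < s < 1 & 0 <= t <= 1].
Proof.
pose n := Num.floor (level q); pose t := level q - n%:~R.
have t01 : 0 <= t <= 1.
  have := floor_itv (level q); rewrite -/n intrD /t; lra.
move=> s01; exists n, (offset q), t; split=> //; rewrite /offset.
rewrite (@left_bound_piece n); last by move: t01; rewrite /t; lra.
rewrite -/t; have [_ _ _ c] := T n.
have tE : t * h = crs e (q - p n).
  rewrite /t -level_tie mulrBl /level !divfK // /crs !cE; ring.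
have /norm_eq1P e1 := unit_dir.
(* [e] and its rotation by a right angle form an orthonormal frame. *)
have frame v v' : dotp e v = dotp e v' -> crs e v = crs e v' -> v = v'.
  have decomp x : x = (dotp e x)%:C * e + (crs e x)%:C * (Complex (- Im e) (Re e)).
    apply: complex_ext; rewrite !cE /dotp /crs /=.
      transitivity ((Re e ^+ 2 + Im e ^+ 2) * Re x); last by ring.
      by rewrite e1 mul1r.
    transitivity ((Re e ^+ 2 + Im e ^+ 2) * Im x); last by ring.
    by rewrite e1 mul1r.
  by move=> d1 d2; rewrite (decomp v) (decomp v') d1 d2.
have linD x y : dotp e (x + y) = dotp e x + dotp e y by rewrite /dotp !cE; ring.
have linZ (r : R) x : dotp e (r%:C * x) = r * dotp e x by rewrite /dotp !cE; ring.
apply: frame; first by rewrite !linD !linZ dotp_ee; ring.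
have -> : crs e q = crs e (p n) + crs e (q - p n) by rewrite /crs !cE; ring.
rewrite -tE -c; set r := (dotp e q - _); rewrite [t * _]mulrC.
by rewrite /crs !cE; ring.
Qed.

Lemma tie_track_of n : tie (track_of e p b) (p n) (p n + e) /\
  tie (track_of e p b) (p n + e) (p n).
Proof.
have [_ hn _ _] := T n.
have [_ hn1 +_] := T (n - 1); rewrite subrK => pn.
have s1 : side (track_of e p b (n - 1)) (p n) (p n + e).
  by apply/sideP; exists (- b (n - 1)); rewrite pn; apply: rhombus_at_up.
have s2 : side (track_of e p b n) (p n) (p n + e) by apply/sideP; exists (b n).
by split; exists (n - 1); rewrite subrK; split=> //; apply: side_sym.
Qed.

(** Ties through the parametrization [p]; in this form an edge of direction other than [e] and [- e]
    is plainly not one. *)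
Definition rung z w :=
  exists n, (z = p n /\ w = p n + e) \/ (z = p n + e /\ w = p n).

Lemma tie_rung z w : rung z w -> tie (track_of e p b) z w.
Proof. by move=> [n [[-> ->]|[-> ->]]]; case: (tie_track_of n). Qed.

(** A point of the edge strictly inside the strip lies in a face [F] of the track, off its two
    lateral sides. It is no corner of [F], so by edge-to-edge contact it lies on a side of [F],
    which can only be a tie, and the edge is that tie. *)
Lemma edge_avoids_strip z w q : adjacent L z w -> ~ rung z w ->
  segment z w q -> (offset q <= 0) || (1 <= offset q).
Proof.
move=> [P LP sP] nt zwq; apply/negP => /negP; rewrite negb_or -!ltNge => st.
apply: nt; have [n [s [t [qE s01 t01]]]] := in_strip st.
have [LF hF pE _] := T n; set F := rhombus _ _ _ in LF hF.
have done z' w' : side F z' w' -> segment z' w' q -> rung z' w'.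
  move=> sF zq; have [c cE c'] := side_meets_strip hF sF zq qE s01 t01.
  case: cE => cE; [exists n|exists (n + 1)]; first by rewrite -cE.
  by rewrite pE -cE.
have [PF|PF] := pselect (P = F); first by apply: done => //; rewrite -PF.
have Pq : P q.
  case: sP => c [_ _ _ _ ->]; case/segmentP: zwq => r r01 ->.
  apply/rhombusP; exists r, 0; split; rewrite ?lexx ?ler01 //.
  by apply: complex_ext; rewrite !cE; ring.
have Fq : F q by apply/rhombusP; exists s, t; split=> //; lra.
have PFq : (P `&` F) q by [].
case: (faces_edge_to_edge LP LF PF) => [E|[z' [_ cz E]]|[z' [w' [sP' sF' E]]]].
- by move: PFq; rewrite E.
- move: PFq cz; rewrite E => <- cq.
  have [d d0 [q1 q2]] := rhombus_at_move hF s01 t01; rewrite -qE in q1 q2.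
  have := corner_support cq q1 q2 => /(congr1 (dotp e)).
  rewrite (_ : dotp e (d%:C * e) = d * dotp e e); last by rewrite /dotp !cE; ring.
  by rewrite dotp_ee mulr1 /dotp /= !mulr0 addr0 => d0'; rewrite d0' ltxx in d0.
- have zq' : segment z' w' q by rewrite -E.
  have [m mE] := done _ _ sF' zq'.
  (* An offset strictly between 0 and 1 puts [q] strictly inside the common side, as [side_overlap]
     requires. *)
  have [r [r01 qr]] : exists r : R, 0 < r < 1 /\ q = z' + r%:C * (w' - z').
    case/segmentP: zq' => r r01 qr; exists r; split=> //.
    move: st; case: mE => -[zE wE].
      rewrite qr zE wE (_ : p m + r%:C * (p m + e - p m) = p m + r%:C * e).
        by rewrite offset_shift offset_tie add0r.
      by ring.
    rewrite qr zE wE (_ : _ + _ = p m + (1 - r)%:C * e).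
      by rewrite offset_shift offset_tie add0r => ?; lra.
    by apply: complex_ext; rewrite !cE; ring.
  exists m; case: sP sP' zwq => c hc [c' hc'] /segmentP[u u01 qu].
  have := side_overlap hc hc' r01 (etrans (esym qu) qr).
  have wz : w = z + (w - z) by ring.
  have wz' : w' = z' + (w' - z') by ring.
  case=> -[e1 e2].
    by have <- : z' = z by []; have <- : w' = w by rewrite wz' wz e2 e1.
  have <- : w' = z by rewrite wz' e2 e1; ring.
  have <- : z' = w by rewrite e1; ring.
  by case: mE => -[? ?]; [right|left].
Qed.

(** Along the edge the offset is continuous and piecewise affine, and by [edge_avoids_strip] it
    never lies strictly between 0 and 1. *)
Lemma edge_one_side z w q q' : adjacent L z w -> ~ rung z w ->
  segment z w q -> segment z w q' -> (offset q <= 0) = (offset q' <= 0).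
Proof.
move=> azw nt; pose g s := offset (z + s%:C * (w - z)).
pose u (s : R) := level (z + s%:C * (w - z)).
have gap (s : R) : 0 <= s <= 1 -> (g s <= 0) || (1 <= g s).
  by move=> ?; apply: (edge_avoids_strip azw nt); apply/segmentP; exists s.
have uE (s s' r : R) : u (s + r * (s' - s)) = u s + r * (u s' - u s).
  by rewrite /u !level_affine; ring.
have mid (s s' r : R) : 0 <= s <= 1 -> 0 <= s' <= 1 -> 0 <= r <= 1 ->
    0 <= s + r * (s' - s) <= 1 by move=> ? ? ?; nra.
have half n (s s' : R) : 0 <= s <= 1 -> 0 <= s' <= 1 ->
    n%:~R <= u s <= n%:~R + 1 -> n%:~R <= u s' <= n%:~R + 1 -> g s <= 0 -> g s' <= 0.
  move=> s01 s01' us us' gs; rewrite leNgt; apply/negP => gs0.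
  have gs' : 1 <= g s' by have := gap _ s01'; rewrite leNgt gs0.
  have ab : 0 < g s' - g s by lra.
  (* The parameter at which the affine offset would take the forbidden value 1/2. *)
  pose r := (2^-1 - g s) / (g s' - g s).
  have r01 : 0 <= r <= 1.
    by rewrite /r divr_ge0 ?ler_pdivrMr ?mul1r //; lra.
  have ur : n%:~R <= u (s + r * (s' - s)) <= n%:~R + 1 by rewrite uE; nra.
  suff gr : g (s + r * (s' - s)) = 2^-1 by have := gap _ (mid _ _ _ s01 s01' r01); rewrite gr; lra.
  have -> : g (s + r * (s' - s)) = g s + r * (g s' - g s).
    rewrite /g /offset !(@left_bound_piece n) // -!/(u _) uE /dotp !cE; ring.
  by rewrite /r divfK ?gt_eqF //; ring.
have piece n (s s' : R) : 0 <= s <= 1 -> 0 <= s' <= 1 ->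
    n%:~R <= u s <= n%:~R + 1 -> n%:~R <= u s' <= n%:~R + 1 ->
    (g s <= 0) = (g s' <= 0).
  by move=> ? ? ? ?; apply/idP/idP; apply: (@half n).
(* Induction on the number [k] of tie levels crossed, stopping at each to apply [piece]. *)
have main (k : nat) (s s' : R) : 0 <= s <= 1 -> 0 <= s' <= 1 -> u s <= u s' ->
    Num.floor (u s') = Num.floor (u s) + k%:Z -> (g s <= 0) = (g s' <= 0).
  elim: k s => [|k IH] s s01 s01' uss fl.
    have := floor_itv (u s); have := floor_itv (u s').
    rewrite fl addr0 !intrD => ? ?.
    by apply: (@piece (Num.floor (u s))) => //; lra.
  pose n := Num.floor (u s).
  have un := floor_itv (u s); rewrite -/n intrD in un.
  have un' : n%:~R + 1 <= u s'.
    have := floor_le (u s'); rewrite fl -/n intrD -pmulrn -natr1.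
    by have := ler0n R k; lra.
  have pos : 0 < u s' - u s by lra.
  pose r := (n%:~R + 1 - u s) / (u s' - u s).
  have r01 : 0 <= r <= 1.
    by rewrite /r divr_ge0 ?ler_pdivrMr ?mul1r //; lra.
  have us2 : u (s + r * (s' - s)) = n%:~R + 1.
    by rewrite uE /r divfK ?gt_eqF //; ring.
  have s2 := mid _ _ _ s01 s01' r01.
  transitivity (g (s + r * (s' - s)) <= 0).
    by apply: (@piece n) => //; rewrite ?us2; lra.
  apply: IH => //; first by rewrite us2.
  rewrite fl us2 (_ : n%:~R + 1 = (n + 1)%:~R); last by rewrite intrD.
  by rewrite intrKfloor -/n -addn1 PoszD; ring.
have all s s' : 0 <= s <= 1 -> 0 <= s' <= 1 -> (g s <= 0) = (g s' <= 0).
  wlog uu : s s' / u s <= u s'.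
    by move=> H ? ?; have /orP[?|?] := le_total (u s) (u s'); [|symmetry]; apply: H.
  move=> ? ?; apply: (main `|Num.floor (u s') - Num.floor (u s)|%N) => //.
  by rewrite gez0_abs ?subr_ge0 ?le_floor //; ring.
by move=> /segmentP[s ? ->] /segmentP[s' ? ->]; apply: all.
Qed.

End Track.
End Tracks.

(** * Connectivity by paths for an arbitrary edge relation *)

Section Joined.
Context {R : realType}.
Variable L : rhombic_lattice R.
Implicit Types (r : R[i] -> R[i] -> Prop) (x y u : vertex L).

Definition joined r x y := exists p, path_to r x p y.

Lemma joined_refl r x : joined r x x.
Proof. by exists [::]. Qed.

Lemma joined_step r x y u : r (val x) (val y) -> joined r y u -> joined r x u.
Proof. by move=> xy [p [pp pe]]; exists (y :: p); split=> //=; rewrite asboolT. Qed.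

Lemma joined_edge r x y : r (val x) (val y) -> joined r x y.
Proof. by move=> xy; apply: joined_step xy (joined_refl _ _). Qed.

(** Paths grow at their start, so the end [y] stays fixed and properties travel backwards from
    it. *)
Lemma joined_ind r (Q : vertex L -> Prop) y : Q y ->
  (forall x u, r (val x) (val u) -> joined r u y -> Q u -> Q x) ->
  forall x, joined r x y -> Q x.
Proof.
move=> Qy step x [p]; elim: p x => [|u p IH] x [] /=; first by move=> _ ->.
move=> /andP[/asboolP xu pu] pe; have up : path_to r u p y by [].
by apply: step xu _ (IH _ up); exists p.
Qed.

Lemma joined_trans r x y u : joined r x y -> joined r y u -> joined r x u.
Proof.
move=> xy yu; move: x xy; apply: joined_ind => // x v xv _ vu.
exact: joined_step xv vu.
Qed.

Lemma joined_sym r x y : (forall z w, r z w -> r w z) -> joined r x y -> joined r y x.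
Proof.
move=> rs; move: x; apply: joined_ind => [|x u xu _ yu]; first exact: joined_refl.
by apply: joined_trans yu (joined_edge _); apply: rs.
Qed.

End Joined.

(** * Reaching an edge of direction [e] along edges of other directions *)

Section FreeEnds.
Context {R : realType}.
Variable L : rhombic_lattice R.
Hypothesis Ltracks : coherent_tracks_on_both_sides L.
Implicit Types (z w : R[i]) (x y u : vertex L).

Definition off_edge (e : R[i]) z w := [/\ adjacent L z w, w - z <> e & w - z <> - e].

Lemma off_edge_sym e z w : off_edge e z w -> off_edge e w z.
Proof.
move=> [a1 a2 a3]; split; first exact: adjacent_sym.
- by move=> E; apply: a3; rewrite -E opprB.
- by move=> E; apply: a2; rewrite -[e]opprK -E opprB.
Qed.

Lemma vertex_of_adjacent z w : adjacent L z w -> exists x, val x = z.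
Proof. by move=> /adjacent_vertex h; exists (exist _ z (mem_set h)). Qed.

Section Direction.
Variable e : R[i].

Lemma is_track_of (h : R) (p b : int -> R[i]) : 0 < h -> track_data L e h p b ->
  is_track L (track_of e p b).
Proof.
move=> h0 T n; have [Ln hn pn cn] := T n; split=> //.
  have [_ hn1 _ cn1] := T (n + 1) => E.
  have : track_of e p b (n + 1) (p (n + 1) + b (n + 1)).
    apply/rhombusP; exists 0, 1; split; rewrite ?lexx ?ler01 //.
    by apply: complex_ext; rewrite !cE; ring.
  rewrite -E pn => /(rhombus_crsP _ _ (rhombus_at_crs hn))[_ /andP[_]].
  have -> : crs e (p n + b n + b (n + 1) - p n) = crs e (b n) + crs e (b (n + 1)).
    by rewrite /crs !cE; ring.
  by rewrite cn1 cn ler_pdivrMr //; apply/negP; lra.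
exists (p n), e, (b n); split=> //; last first.
  have [_ hn1 _ _] := T (n + 1).
  rewrite (_ : p n + b n + e = p (n + 1) + e); last by rewrite pn.
  by rewrite -pn; apply/sideP; exists (b (n + 1)).
have [_ hm + _] := T (n - 1); rewrite subrK => ->.
by apply/sideP; exists (- b (n - 1)); apply: rhombus_at_up.
Qed.

Lemma track_has_tie F : is_track L F ->
  exists z w, [/\ adjacent L z w, corner (F 0) z, corner (F 0) w & tie F z w].
Proof.
move=> /(_ 0)[LF _ [z [a [b [h _ s]]]]].
have h1 : rhombus_at (F 0) (z + b) a (- b) by apply: rhombus_at_up.
have s0 : side (F 0) (z + b) (z + b + a) by apply/sideP; exists (- b).
exists (z + b), (z + b + a); split; last by exists 0.
- by exists (F 0).
- by exists a, (- b).
- by exists (- a), (- b); apply: rhombus_at_flip.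
Qed.

(** Ties are unit vectors, and a real ratio of modulus 1 is 1 or -1. *)
Lemma coherent_tie_dir F F' z w z' w' : coherent F F' -> tie F z w -> tie F' z' w' ->
  w' - z' = w - z \/ w' - z' = - (w - z).
Proof.
move=> c t t'; have := c _ _ _ _ t t'.
case: t => n [[b1 [n1 _ _ _ _]] _]; case: t' => m [[b2 [n2 _ _ _ _]] _].
have wz0 : w - z != 0 by rewrite -normr_eq0 n1 oner_eq0.
set k := (w' - z') / (w - z) => kr.
have kE : w' - z' = k * (w - z) by rewrite /k divfK.
have : `|k| == `|1|.
  by rewrite normr1; move: n2; rewrite kE normrM n1 mulr1 => ->.
rewrite real_eqr_norm2 ?real1 // kE => /orP[/eqP ->|/eqP ->].
  by left; rewrite mul1r.
by right; rewrite mulN1r.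
Qed.

Lemma tie_joined F x z w : is_track L F -> tie F z w -> w - z = e ->
  exists y, adjacent L (val y) (val y + e) /\
    joined (fun z w => adjacent L z w /\ ~ tie F z w) x y.
Proof.
move=> tF tz zw; have [F' [tF' cF inF]] := Ltracks tF x.
have [z' [w' [azw cz cw tz']]] := track_has_tie tF'.
case: (coherent_tie_dir cF tz tz'); rewrite zw => E.
  have [y yE] := vertex_of_adjacent azw.
  exists y; split; last by apply: (inF 0); rewrite yE.
  by rewrite yE -E addrC subrK.
have awz := adjacent_sym azw.
have [y yE] := vertex_of_adjacent awz.
exists y; split; last by apply: (inF 0); rewrite yE.
by rewrite yE (_ : w' + e = z') // -[e]opprK -E; ring.
Qed.

(* Following a path to a tie of a coherent track, stop at the first edge of
   direction [e] or [- e]. *)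
Lemma first_parallel_edge F x z w : is_track L F -> tie F z w -> w - z = e ->
  (exists y, joined (off_edge e) x y /\ adjacent L (val y) (val y + e)) \/
  (exists y, [/\ joined (off_edge e) x y, adjacent L (val y) (val y - e) &
     ~ tie F (val y) (val y - e)]).
Proof.
move=> tF tz zw; have [y [ye]] := tie_joined x tF tz zw.
move: x; apply: joined_ind => [|x u [xu ntxu] _].
  by left; exists y; split=> //; apply: joined_refl.
have [E|nE] := pselect (val u - val x = e).
  move=> _; left; exists x; split; first exact: joined_refl.
  by rewrite -E addrC subrK.
have [E'|nE'] := pselect (val u - val x = - e).
  move=> _; right; exists x.
  have -> : val x - e = val u by rewrite -E' addrC subrK.
  by split=> //; apply: joined_refl.
have st : off_edge e (val x) (val u) by [].
case=> [[v [uv ve]]|[v [uv ve vt]]]; [left|right]; exists v; split=> //;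
  exact: joined_step st uv.
Qed.

Lemma int_shift_ind (Q : int -> Prop) : Q 0 -> (forall n, Q n <-> Q (n + 1)) ->
  forall n, Q n.
Proof.
move=> Q0 S; case=> n; first by elim: n => // n /S; rewrite -PoszD addn1.
elim: n => [|n]; first by apply/S.
by move=> h; apply/S; rewrite (_ : Negz n.+1 + 1 = Negz n) // !NegzE -addn1 PoszD; ring.
Qed.

Section OffsetJoined.
Variables (h : R) (p b : int -> R[i]).
Hypotheses (h0 : 0 < h) (T : track_data L e h p b).

Lemma off_edge_not_rung z w : off_edge e z w -> ~ rung e p z w.
Proof.
move=> [_ n1 n2] [n [[zE wE]|[zE wE]]]; [apply: n1|apply: n2];
  by rewrite zE wE; ring.
Qed.

Lemma segment_ends z w : segment z w z /\ segment z w w.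
Proof.
split; apply/segmentP; [exists 0|exists 1]; rewrite ?lexx ?ler01 //;
  by apply: complex_ext; rewrite !cE; ring.
Qed.

(** Paths avoiding the directions [e] and [- e] cross no tie, so they stay on one side of the
    strip. *)
Lemma offset_joined x y : joined (off_edge e) x y ->
  (offset e h p b (val x) <= 0) = (offset e h p b (val y) <= 0).
Proof.
move: x; apply: joined_ind => // x u xu _ <-.
have [s1 s2] := segment_ends (val x) (val u).
by apply: (edge_one_side h0 T _ (off_edge_not_rung xu)) => //; case: xu.
Qed.

(** The right boundary has edges [b n], which are not parallel to [e] because
    [crs e (b n) = h > 0]. *)
Lemma right_ends_joined : exists v : int -> vertex L,
  [/\ forall n, val (v n) = p n + e,
      forall n, off_edge e (val (v n)) (val (v (n + 1))) &
      forall n, joined (off_edge e) (v 0) (v n)].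
Proof.
have ends n : adjacent L (p n + e) (p (n + 1) + e).
  have [LF hF -> _] := T n; exists (rhombus (p n) e (b n)) => //.
  rewrite (_ : p n + b n + e = p n + e + b n); last by ring.
  by apply/sideP; exists (- e); apply: rhombus_at_swap; apply: rhombus_at_flip.
have /choice[v vE] n : exists x : vertex L, val x = p n + e.
  exact: vertex_of_adjacent (ends n).
have st n : off_edge e (val (v n)) (val (v (n + 1))).
  rewrite !vE; split=> //; have [_ hF pn c] := T n; rewrite pn.
    move=> E; have E' : b n = e by rewrite -E; ring.
    by move: c; rewrite E' crs_ee => c; move: h0; rewrite -c ltxx.
  move=> E; have E' : b n = - e by rewrite -E; ring.
  move: c; rewrite E' (_ : crs e (- e) = 0) => [c|]; first by move: h0; rewrite -c ltxx.
  by rewrite /crs !cE; ring.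
exists v; split=> //.
apply: int_shift_ind => [|n]; first exact: joined_refl.
split=> [H|H]; apply: joined_trans H (joined_edge _) => //.
exact: off_edge_sym.
Qed.

End OffsetJoined.

Theorem free_edge x : directions L e ->
  exists y, joined (off_edge e) x y /\ adjacent L (val y) (val y + e).
Proof.
move=> [z [w [azw ew]]]; apply: contrapT => none.
have ze : adjacent L z (z + e) by rewrite ew addrC subrK.
have dirE (p : int -> R[i]) n : p n + e - p n = e by ring.
have [h [p [b [h0 T _]]]] := track_through ze.
(* By [none], each search for a parallel edge ends at the right end of one: first [u1], which yields
   the track of [p1], then [u2], whose edge is not a tie of that track. *)
have [//|[u1 [xu1 au1 _]]] := first_parallel_edge x (is_track_of h0 T)
  (proj1 (tie_track_of T 0)) (dirE _ _).
move: au1 => /adjacent_sym; rewrite -[X in adjacent L _ X](subrK e).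
move=> /track_through[h1 [p1 [b1 [h10 T1 p10]]]].
have [//|[u2 [xu2 au2 nt]]] := first_parallel_edge x (is_track_of h10 T1)
  (proj1 (tie_track_of T1 0)) (dirE _ _).
move: (au2) => /adjacent_sym; rewrite -[X in adjacent L _ X](subrK e).
move=> /track_through[h2 [p2 [b2 [h20 T2 p20]]]].
have sh (q : R[i]) : q - e = q + (-1)%:C * e.
  by apply: complex_ext; rewrite !cE; ring.
have o1 : offset e h1 p1 b1 (val u1) = 1.
  have := offset_tie h10 T1 0; rewrite p10 sh (offset_shift h10 T1) => /eqP.
  by rewrite subr_eq0 => /eqP.
have o2 : offset e h2 p2 b2 (val u2) = 1.
  have := offset_tie h20 T2 0; rewrite p20 sh (offset_shift h20 T2) => /eqP.
  by rewrite subr_eq0 => /eqP.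
have u1x : joined (off_edge e) u1 x by apply: joined_sym xu1; apply: off_edge_sym.
have u12 := joined_trans u1x xu2.
have [v [vE st vj]] := right_ends_joined h10 T1.
have v0 : v 0 = u1 by apply: val_inj; rewrite vE p10 subrK.
pose n := Num.floor (level e h1 p1 (val u2)).
pose t := level e h1 p1 (val u2) - n%:~R.
have t01 : 0 <= t <= 1.
  by have := floor_itv (level e h1 p1 (val u2)); rewrite -/n intrD /t; lra.
(* [r] is the point of the right boundary of the strip of [p1] at the height of [u2]. *)
pose r0 := p1 n + t%:C * b1 n; pose r := r0 + 1%:C * e.
have [LF hF pn c] := T1 n.
have lr0 : level e h1 p1 r0 = level e h1 p1 (val u2).
  rewrite /r0 (level_affine _ _ h10) (level_tie h10 T1) c divff ?gt_eqF // mulr1.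
  by rewrite /t; ring.
have lr : level e h1 p1 r = level e h1 p1 (val u2).
  by rewrite /r (level_affine _ _ h10) crs_ee mul0r mulr0 addr0.
have or1 : offset e h1 p1 b1 r = 1.
  by rewrite /r (offset_shift h10 T1) /r0 (offset_face h10 T1) // add0r.
(* The right boundary of the strip of [p1] is joined to [u2], a right tie end of the strip of [p2],
   hence lies right of the latter strip. *)
have or2 : 1 <= offset e h2 p2 b2 r.
  have seg : segment (val (v n)) (val (v (n + 1))) r.
    apply/segmentP; exists t => //; rewrite !vE pn /r /r0.
    by apply: complex_ext; rewrite !cE; ring.
  have [adj _ _] := st n.
  have := edge_avoids_strip h20 T2 adj (off_edge_not_rung (st n)) seg.
  rewrite (edge_one_side h20 T2 adj (off_edge_not_rung (st n)) seg
     (proj1 (segment_ends _ _))).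
  rewrite (offset_joined h20 T2 (y := u2)) ?o2 ?ler10 //.
  apply: joined_trans u12; rewrite -v0; apply: joined_sym (vj n).
  exact: off_edge_sym.
(* Conversely, the edge from [u2] to [u2 - e] is no tie of the track of [p1], so all of it lies
   right of that strip. *)
have oe : 1 <= offset e h1 p1 b1 (val u2 - e).
  have nr : ~ rung e p1 (val u2) (val u2 - e) by move=> /(tie_rung T1).
  have [s1 s2] := segment_ends (val u2) (val u2 - e).
  have := edge_avoids_strip h10 T1 au2 nr s2.
  rewrite (edge_one_side h10 T1 au2 nr s2 s1).
  by rewrite -(offset_joined h10 T1 u12) o1 ler10.
(* At their common height, [u2] is at least 1 to the right of [r], yet [r] is not to the left of
   [u2]. *)
move: oe or1 or2 o2; rewrite sh (offset_shift h10 T1) /offset.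
rewrite (left_bound_level b1 lr).
rewrite (left_bound_level b2 (_ : level e h2 p2 r = level e h2 p2 (val u2))).
  by lra.
by apply/(crs_level e p2 h20); apply/(crs_level e p1 h10).
Qed.

End Direction.
End FreeEnds.

(** * Hilbert spaces *)

Section RealNorm.
Context {R : realType}.

(* The norms of complex normed modules take values in [R[i]]. *)
Definition rnorm (V : normedZmodType R[i]) (x : V) : R := Re `|x|.

Lemma rnormE (V : normedZmodType R[i]) (x : V) : `|x| = (rnorm x)%:C.
Proof. by rewrite /rnorm RRe_real // normr_real. Qed.

Lemma rnorm_ge0 (V : normedZmodType R[i]) (x : V) : 0 <= rnorm x.
Proof. by rewrite -lecR -rnormE normr_ge0. Qed.

Lemma rnorm_eq0 (V : normedZmodType R[i]) (x : V) : rnorm x = 0 -> x = 0.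
Proof. by move=> h; apply/eqP; rewrite -normr_eq0 rnormE h. Qed.

Lemma rnormM (x y : R[i]) : rnorm (x * y) = rnorm x * rnorm y.
Proof. by apply/complexI; rewrite rmorphM /= -!rnormE normrM. Qed.

End RealNorm.

(** * Bounded operators with real bounds *)

Section BoundedOperators.
Context {R : realType}.
Implicit Types M N P : normedModType R[i].

Lemma bounded_opP M N (T : M -> N) : bounded_op T <->
  linear T /\ exists2 c : R, 0 <= c & forall x, rnorm (T x) <= c * rnorm x.
Proof.
split=> -[lT]; last first.
  move=> [c _ h]; split=> //; exists c%:C => x.
  by rewrite !rnormE -rmorphM lecR.
(* Only the real part of [c] enters the inequality; the absolute value covers a negative [c],
   possible on the zero space. *)
move=> [c h]; split=> //; exists `|Re c| => // x.
apply: (@le_trans _ _ (Re c * rnorm x)); last by rewrite ler_wpM2r ?rnorm_ge0 ?ler_norm.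
have := h x; rewrite [`|x|]rnormE lecE => /andP[_]; rewrite -/(rnorm (T x)).
by case: (c) => a b /=; rewrite mulr0 subr0.
Qed.

Lemma bounded_op_comp M N P (T : N -> P) (S : M -> N) :
  bounded_op T -> bounded_op S -> bounded_op (T \o S).
Proof.
move=> /bounded_opP[lT [c c0 hc]] /bounded_opP[lS [d d0 hd]]; apply/bounded_opP.
split=> [a x y /=|]; first by rewrite lS lT.
exists (c * d); first by rewrite mulr_ge0.
by move=> x /=; rewrite (le_trans (hc _)) // -mulrA ler_wpM2l.
Qed.

Lemma bounded_op_cvg M N (T : M -> N) (u : nat -> M) (l : M) :
  bounded_op T -> u @ \oo --> l -> (T \o u) @ \oo --> T l.
Proof.
move=> /bounded_opP[lT [c c0 hc]] /cvgrPdist_lt ul; apply/cvgrPdist_lt => e e0.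
(* [c + 1] replaces [c], which may be 0. *)
have d0 : 0 < e / (c + 1)%:C by rewrite divr_gt0 // ltcR; lra.
near=> n.
have lB x y : T (x - y) = T x - T y.
  by rewrite -scaleN1r addrC lT scaleN1r addrC.
rewrite /= -lB (@le_lt_trans _ _ (c%:C * `|l - u n|)) //.
  by rewrite !rnormE -rmorphM lecR hc.
rewrite (@le_lt_trans _ _ ((c + 1)%:C * `|l - u n|)) //.
  by rewrite ler_wpM2r // lecR; lra.
rewrite mulrC -ltr_pdivlMr; last by rewrite ltcR; lra.
by near: n; apply: ul.
Unshelve. all: by end_near. Qed.

End BoundedOperators.

(** * Projection, Riesz representation, adjoints and isometries *)

Section HilbertSpaces.
Context {R : realType}.
Implicit Types H M N : hilbertType R.

Lemma dot_norm H (x : H) : hdot x x = (rnorm x ^+ 2)%:C.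
Proof. by rewrite hdot_norm rnormE -rmorphXn. Qed.

Lemma dotC H (x y : H) : hdot x y = (hdot y x)^*%R.
Proof. by rewrite hermC expr0 mul1r. Qed.

Lemma dotZr H (a : R[i]) (x y : H) : hdot x (a *: y) = a^*%R * hdot x y.
Proof. by rewrite linearZr_LR. Qed.

Lemma dotZl H (a : R[i]) (x y : H) : hdot (a *: x) y = a * hdot x y.
Proof. by rewrite linearZl_LR. Qed.

Lemma dotDl H (x y z : H) : hdot (x + y) z = hdot x z + hdot y z.
Proof. by rewrite linearDl. Qed.

Lemma dotBl H (x y z : H) : hdot (x - y) z = hdot x z - hdot y z.
Proof. by rewrite linearBl. Qed.

Lemma dotDr H (x y z : H) : hdot x (y + z) = hdot x y + hdot x z.
Proof. by rewrite linearDr. Qed.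

Lemma dotNl H (x y : H) : hdot (- x) y = - hdot x y.
Proof. by rewrite linearNl. Qed.

Lemma dotNr H (x y : H) : hdot x (- y) = - hdot x y.
Proof. by rewrite linearNr. Qed.

Lemma dotBr H (x y z : H) : hdot x (y - z) = hdot x y - hdot x z.
Proof. by rewrite linearBr. Qed.

Lemma dot0l H (x : H) : hdot 0 x = 0.
Proof. by rewrite linear0l. Qed.

Lemma dot_eq0C H (x y : H) : hdot x y = 0 -> hdot y x = 0.
Proof. by rewrite dotC => /eqP; rewrite conjC_eq0 => /eqP. Qed.

Lemma dot_self_eq0 H (x : H) : hdot x x = 0 -> x = 0.
Proof.
rewrite dot_norm => /(@complexI _ _ 0) /eqP; rewrite sqrf_eq0 => /eqP.
exact: rnorm_eq0.
Qed.

Lemma pythagoras H (x y : H) : hdot x y = 0 ->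
  rnorm (x + y) ^+ 2 = rnorm x ^+ 2 + rnorm y ^+ 2.
Proof.
move=> xy; apply/complexI; rewrite rmorphD /= -!dot_norm dotDl !dotDr.
by rewrite xy (dot_eq0C xy) addr0 add0r.
Qed.

Lemma rnormZ H (a : R[i]) (x : H) : rnorm (a *: x) = rnorm a * rnorm x.
Proof. by apply/complexI; rewrite rmorphM /= -!rnormE normrZ. Qed.

Lemma rnormV (x : R[i]) : rnorm x^-1 = (rnorm x)^-1.
Proof. by apply/complexI; rewrite fmorphV /= -!rnormE normfV. Qed.

Lemma rnorm_real (x : R) : 0 <= x -> rnorm x%:C = x.
Proof. by move=> x0; apply/complexI; rewrite -rnormE ger0_norm // lecR. Qed.

(** Pythagoras for the component of [x] along [y] and the remainder. *)
Lemma dot_split H (x y : H) : y != 0 ->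
  rnorm x ^+ 2 = rnorm (x - (hdot x y / hdot y y) *: y) ^+ 2 +
    (rnorm (hdot x y) / rnorm y) ^+ 2.
Proof.
move=> y0; set c := _ / _.
have ny : rnorm y != 0 by apply: contraNneq y0 => /rnorm_eq0 ->.
have yy : hdot y y != 0 by apply: contraNneq y0 => /dot_self_eq0 ->.
have ort : hdot (x - c *: y) (c *: y) = 0.
  by rewrite dotZr dotBl dotZl divfK // subrr mulr0.
have := pythagoras ort; rewrite subrK => ->; congr (_ + _ ^+ 2).
rewrite rnormZ /c rnormM rnormV dot_norm rnorm_real ?sqr_ge0 //.
by field.
Qed.

Lemma cauchy_schwarz H (x y : H) : rnorm (hdot x y) <= rnorm x * rnorm y.
Proof.
have [->|y0] := eqVneq y 0.
  by rewrite (dot_eq0C (dot0l _)) /rnorm !normr0 mulr0.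
have ny : 0 < rnorm y.
  by rewrite lt_def rnorm_ge0 andbT; apply: contraNneq y0 => /rnorm_eq0 ->.
rewrite -ler_pdivrMr // -(@ler_pXn2r _ 2) ?nnegrE ?divr_ge0 ?rnorm_ge0 //.
by rewrite (dot_split x y0) lerDr sqr_ge0.
Qed.

Lemma dot_bounded H (y : H) : bounded_op (fun x => hdot x y : R[i]^o).
Proof.
apply/bounded_opP; split=> [a u v|]; first by rewrite dotDl dotZl.
by exists (rnorm y) => [|x]; rewrite ?rnorm_ge0 // mulrC; apply: cauchy_schwarz.
Qed.

Lemma dot_cvg H (u : nat -> H) (l y : H) : u @ \oo --> l ->
  (fun n => hdot (u n) y : R[i]^o) @ \oo --> (hdot l y : R[i]^o).
Proof. exact: (bounded_op_cvg (dot_bounded y)). Qed.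

Lemma dot_cvg_eq H M (u : nat -> H) (l y : H) (v : nat -> M) (k z : M) :
  u @ \oo --> l -> v @ \oo --> k -> (forall n, hdot (u n) y = hdot (v n) z) ->
  hdot l y = hdot k z.
Proof.
move=> ul vk uv; have := dot_cvg (y := z) vk.
rewrite (_ : (fun n => _) = (fun n => hdot (u n) y)); last by apply/funext.
exact: (cvg_unique (@norm_hausdorff _ _) (dot_cvg (y := y) ul)).
Qed.

Definition seq_closed H (S : set H) := forall (u : nat -> H) (l : H),
  (forall n, S (u n)) -> u @ \oo --> l -> S l.

Definition subspace H (S : set H) := S 0 /\
  forall (a : R[i]) x y, S x -> S y -> S (a *: x + y).

Lemma parallelogram H (x y : H) : rnorm (x + y) ^+ 2 + rnorm (x - y) ^+ 2 =
  2 * rnorm x ^+ 2 + 2 * rnorm y ^+ 2.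
Proof.
apply/complexI; rewrite !rmorphD !rmorphM !rmorph_nat -!expr2 -!rmorphXn /= -!dot_norm.
by rewrite !(dotDl, dotDr) !(dotNl, dotNr); ring.
Qed.

(** The parallelogram law makes a minimizing sequence [u] Cauchy. Orthogonality holds approximately
    for each [x - u n] and exactly in the limit. *)
Lemma projection H (S : set H) : subspace S -> seq_closed S ->
  forall x, exists2 p, S p & forall y, S y -> hdot (x - p) y = 0.
Proof.
move=> [S0 Slin] Scl x.
pose D := [set r | exists2 y, S y & r = rnorm (x - y) ^+ 2].
have Dinf : has_inf D.
  split; first by exists (rnorm (x - 0) ^+ 2), 0.
  by exists 0 => _ [y _ ->]; apply: sqr_ge0.
pose d := inf D.
have dle y : S y -> d <= rnorm (x - y) ^+ 2.
  by move=> Sy; apply: ge_inf; [case: Dinf|exists y].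
have /choice[u hu] (n : nat) :
    exists y, S y /\ rnorm (x - y) ^+ 2 < d + n.+1%:R^-1.
  have n0 : 0 < n.+1%:R^-1 :> R by rewrite invr_gt0 ltr0n.
  by have [_ [y Sy ->] hy] := inf_adherent n0 Dinf; exists y.
have close n m : rnorm (u n - u m) ^+ 2 <= 2 * (n.+1%:R^-1 + m.+1%:R^-1).
  have [Sn hn] := hu n; have [Sm hm] := hu m.
  have Sc : S (2^-1 *: (u n + u m)).
    rewrite -[_ *: _]addr0; apply: (Slin) => //.
    by rewrite -[u n]scale1r; apply: (Slin).
  have := parallelogram (x - u n) (x - u m).
  have -> : x - u n - (x - u m) = - (u n - u m).
    by rewrite !opprB addrC addrA subrK.
  have -> : x - u n + (x - u m) = 2 *: (x - 2^-1 *: (u n + u m)).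
    rewrite scalerBr scalerA divff ?pnatr_eq0 // scale1r scaler_nat mulr2n.
    by rewrite addrACA opprD.
  have -> : rnorm (- (u n - u m)) = rnorm (u n - u m) by rewrite /rnorm normrN.
  rewrite rnormZ (_ : rnorm 2 = 2); last first.
    by apply/complexI; rewrite -rnormE normr_nat rmorph_nat.
  have := dle _ Sc; move: hn hm; set a := n.+1%:R^-1; set b := m.+1%:R^-1.
  by rewrite exprMn; lra.
have /cauchy_cvg /cvg_ex[p up] : cauchy (u @ \oo).
  apply: cauchy_exP => e e0.
  have eE : e = (Re e)%:C by rewrite RRe_real // gtr0_real.
  have r0 : 0 < Re e by move: e0; rewrite eE ltcR.
  (* [N + 1 > 4 / e^2], so the bound in [close] falls below [e^2] from [N] on. *)
  pose N := Num.truncn (4 / Re e ^+ 2).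
  exists (u N), N => // n /= Nn; rewrite -ball_normE /= eE rnormE ltcR.
  rewrite -(@ltr_pXn2r _ 2) ?nnegrE ?rnorm_ge0 ?ltW // (le_lt_trans (close _ _)) //.
  have N0 : 0 < N.+1%:R :> R by rewrite ltr0n.
  have nN : n.+1%:R^-1 <= N.+1%:R^-1 :> R by rewrite lef_pV2 ?posrE ?ltr0n // ler_nat ltnS.
  have : N.+1%:R^-1 < Re e ^+ 2 / 4 :> R.
    rewrite -[ltRHS]invrK ltf_pV2 ?posrE ?invr_gt0 ?divr_gt0 ?exprn_gt0 //.
    by rewrite invf_div truncnS_gt.
  by move: nN; set a := n.+1%:R^-1; set b := N.+1%:R^-1; lra.
exists p; first by apply: (Scl u) => // n; case: (hu n).
move=> y Sy; have [->|y0] := eqVneq y 0; first exact: dot_eq0C (dot0l _).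
have ny : 0 < rnorm y.
  by rewrite lt_def rnorm_ge0 andbT; apply: contraNneq y0 => /rnorm_eq0 ->.
(* Correcting [u n] along [y] cannot bring the squared distance below [d], and it exceeds [d] by
   less than [1 / (n + 1)]. *)
have small n : rnorm (hdot (x - u n) y) ^+ 2 <= n.+1%:R^-1 * rnorm y ^+ 2.
  have [Sn hn] := hu n.
  have Sc : S ((hdot (x - u n) y / hdot y y) *: y + u n) by apply: (Slin).
  rewrite -ler_pdivrMr ?exprn_gt0 // -expr_div_n.
  have := dot_split (x - u n) y0; have := dle _ Sc.
  rewrite opprD addrA [x - _ - _]addrAC; move: hn; set a := n.+1%:R^-1.
  by set b := (_ / _) ^+ 2; lra.
have lim0 : (fun n => hdot (x - u n) y : R[i]^o) @ \oo --> (0 : R[i]^o).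
  apply/cvgrPdist_lt => e e0.
  have eE : e = (Re e)%:C by rewrite RRe_real // gtr0_real.
  have r0 : 0 < Re e by move: e0; rewrite eE ltcR.
  pose N := Num.truncn (rnorm y ^+ 2 / Re e ^+ 2).
  exists N => // n /= Nn; rewrite sub0r normrN eE rnormE ltcR.
  rewrite -(@ltr_pXn2r _ 2) ?nnegrE ?rnorm_ge0 ?ltW // (le_lt_trans (small _)) //.
  rewrite mulrC ltr_pdivrMr ?ltr0n // -ltr_pdivrMl ?exprn_gt0 // mulrC.
  by apply: lt_le_trans (truncnS_gt _) _; rewrite ler_nat ltnS.
have lim : (fun n => hdot (x - u n) y : R[i]^o) @ \oo --> (hdot (x - p) y : R[i]^o).
  by apply: (@dot_cvg _ (fun n => x - u n)); apply: cvgB => //; apply: cvg_cst.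
exact: (cvg_unique (@norm_hausdorff _ _) lim lim0).
Qed.

(** The representing vector is a multiple of some [v] orthogonal to the closed kernel of [phi]. *)
Lemma riesz H (phi : H -> R[i]^o) : bounded_op phi ->
  exists y, forall x, phi x = hdot x y.
Proof.
move=> bphi; have [lphi _] := bphi.
have phi0 : phi 0 = 0.
  by have := lphi (-1) 0 0; rewrite scaler0 addr0 scaleN1r addNr.
have phiB x y : phi (x - y) = phi x - phi y.
  by rewrite -scaleN1r addrC lphi scaleN1r addrC.
have [h|/existsNP[x0 hx0]] := pselect (forall x, phi x = 0).
  by exists 0 => x; rewrite h (dot_eq0C (dot0l _)).
pose K := [set x | phi x = 0].
have Ksub : subspace K.
  split=> [|a x y /= hx hy]; first exact: phi0.
  by rewrite /K /= lphi hx hy scaler0 addr0.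
have Kcl : seq_closed K.
  move=> u l Ku ul; have := bounded_op_cvg bphi ul.
  rewrite (_ : _ \o _ = fun=> 0); last by apply/funext => n /=; apply: Ku.
  move=> lim; apply: (cvg_unique (@norm_hausdorff _ _) lim); exact: cvg_cst.
have [p Kp ort] := projection Ksub Kcl x0.
set v := x0 - p in ort.
have phiv : phi v != 0 by rewrite phiB [phi p]Kp subr0; apply/eqP.
have vv : hdot v v != 0.
  by apply: contraNneq phiv => /dot_self_eq0 ->; rewrite phi0.
(* The conjugate compensates for conjugate-linearity in the second argument. *)
exists ((phi v / hdot v v)^* *: v) => x.
rewrite dotZr conjCK.
have Kx : K (x - (phi x / phi v) *: v).
  rewrite /K /= phiB -[_ *: v]addr0 lphi phi0 addr0.
  by rewrite (_ : _ *: _ = phi x / phi v * phi v) // divfK // subrr.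
have := dot_eq0C (ort _ Kx); rewrite dotBl dotZl => /eqP.
rewrite subr_eq0 => /eqP ->.
by field; rewrite phiv vv.
Qed.

(** Riesz provides a function with the defining property, so [xget] does not fall back on its
    default. *)
Lemma adjointP M N (T : M -> N) : bounded_op T ->
  forall x y, hdot (T x) y = hdot x (adjoint T y).
Proof.
move=> bT.
have /choice[S hS] y : exists z, forall x, hdot (T x) y = hdot x z.
  exact: (riesz (bounded_op_comp (dot_bounded y) bT)).
rewrite /adjoint; case: xgetP => [S' _ //|/(_ S) /=].
by move=> /(_ (fun x y => hS y x)).
Qed.

Lemma dot_inj H (x y : H) : (forall z, hdot z x = hdot z y) -> x = y.
Proof.
move=> h; apply/eqP; rewrite -subr_eq0; apply/eqP/dot_self_eq0.
by rewrite dotBr h subrr.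
Qed.

(** The square of the norm of [adjoint T y] equals [hdot (T (adjoint T y)) y], to which
    Cauchy-Schwarz applies. *)
Lemma adjoint_bounded M N (T : M -> N) : bounded_op T -> bounded_op (adjoint T).
Proof.
move=> bT; have adj := adjointP bT; have /bounded_opP[_ [c c0 hc]] := bT.
apply/bounded_opP; split=> [a x y|].
  by apply: dot_inj => z; rewrite dotDr dotZr -!adj dotDr dotZr.
exists c => // y; have [->|y0] := eqVneq (adjoint T y) 0.
  by rewrite /rnorm normr0 mulr_ge0 ?rnorm_ge0.
have ny : 0 < rnorm (adjoint T y).
  by rewrite lt_def rnorm_ge0 andbT; apply: contraNneq y0 => /rnorm_eq0 ->.
rewrite -(ler_pM2l ny) -expr2 -(rnorm_real (sqr_ge0 _)) -dot_norm -adj.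
rewrite (le_trans (cauchy_schwarz _ _)) //.
by rewrite mulrCA mulrA ler_wpM2r ?rnorm_ge0.
Qed.

(* The pairs [(f, p)] orthogonal, in the sense of [hdot f g = hdot p q], to all
   pairs [(g, q)] that are themselves orthogonal to the [(k i, m i)]; an
   isometric closed relation, whose domain contains the total family [k]. *)
Lemma gram_isometry H M (I : Type) (k : I -> H) (m : I -> M) :
  (forall i j, hdot (k i) (k j) = hdot (m i) (m j)) ->
  (forall f, (forall i, hdot f (k i) = 0) -> f = 0) ->
  exists V : H -> M, [/\ bounded_op V, forall i, V (k i) = m i &
    forall f i, hdot f (k i) = hdot (V f) (m i)].
Proof.
move=> gram tot.
pose E g q := forall i, hdot g (k i) = hdot q (m i).
pose r f p := E f p /\ forall g q, E g q -> hdot f g = hdot p q.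
have rk i : r (k i) (m i).
  split=> [j|g q Egq]; first exact: gram.
  by rewrite dotC Egq -dotC.
have rlin a f p g q : r f p -> r g q -> r (a *: f + g) (a *: p + q).
  move=> [e1 h1] [e2 h2]; split=> [i|g' q' e'].
    by rewrite !dotDl !dotZl e1 e2.
  by rewrite !dotDl !dotZl (h1 _ _ e') (h2 _ _ e').
have riso f p : r f p -> rnorm p = rnorm f.
  move=> [e h]; apply/eqP; rewrite -(@eqrXn2 _ 2) ?rnorm_ge0 //; apply/eqP.
  by apply/complexI; rewrite -!dot_norm (h _ _ e).
have r0 : r 0 0.
  by split=> [i|g q _]; rewrite !dot0l.
have rB f p g q : r f p -> r g q -> r (f - g) (p - q).
  move=> h1 h2; have -> : f - g = -1 *: g + f by rewrite scaleN1r addrC.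
  by have -> : p - q = -1 *: q + p; [rewrite scaleN1r addrC|apply: rlin].
have runiq f p q : r f p -> r f q -> p = q.
  move=> h1 h2; have := riso _ _ (rB _ _ _ _ h1 h2).
  rewrite subrr [RHS]/rnorm normr0 => /rnorm_eq0 /eqP.
  by rewrite subr_eq0 => /eqP.
pose D := [set f | exists p, r f p].
have Dsub : subspace D.
  split=> [|a f g [p fp] [q gq]]; first by exists 0.
  by exists (a *: p + q); apply: rlin.
have Dcl : seq_closed D.
  move=> u l /choice[v uv] ul.
  (* The relation is isometric, so the partners of a convergent sequence form a Cauchy sequence. *)
  have /cauchy_cvg /cvg_ex[p vp] : cauchy (v @ \oo).
    apply: cauchy_exP => e e0.
    have e2 : 0 < e / 2 by rewrite divr_gt0.
    have /cvgrPdist_lt /(_ _ e2) [N _ hN] := ul.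
    exists (v N), N => // n /= Nn; rewrite -ball_normE /= rnormE.
    rewrite (riso _ _ (rB _ _ _ _ (uv N) (uv n))) -rnormE.
    rewrite (_ : u N - u n = (l - u n) - (l - u N)); last first.
      by rewrite opprB [RHS]addrC addrA subrK.
    rewrite (le_lt_trans (ler_normB _ _)) // [e]splitr ltrD //; apply: hN => //=.
  exists p; split=> [i|g q e].
    by apply: dot_cvg_eq ul vp _ => n; case: (uv n).
  by apply: dot_cvg_eq ul vp _ => n; case: (uv n) => _; apply.
(* [D] is a closed subspace containing the total family [k], so its orthogonal complement is
   zero. *)
have Dall f : D f.
  have [g Dg ort] := projection Dsub Dcl f.
  suff -> : f = g by [].
  apply/eqP; rewrite -subr_eq0; apply/eqP/tot => i; apply: ort.
  by exists (m i).
have /choice[V hV] f : exists p, r f p by apply: Dall.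
exists V; split=> [|i|f i]; last by case: (hV f).
- apply/bounded_opP; split=> [a f g|].
    by apply: runiq (hV _) _; apply: rlin.
  by exists 1 => // f; rewrite mul1r (riso _ _ (hV f)).
- exact: runiq (hV _) (rk i).
Qed.

End HilbertSpaces.

(** * Discrete analytic functions *)

Section LinearMaps.
Context {R : realType} {V W : lmodType R[i]}.
Variable phi : V -> W.
Hypothesis lphi : linear phi.

Lemma linfunD x y : phi (x + y) = phi x + phi y.
Proof. by rewrite -[x in LHS]scale1r lphi scale1r. Qed.

Lemma linfun0 : phi 0 = 0.
Proof. by apply: (addrI (phi 0)); rewrite -linfunD !addr0. Qed.

Lemma linfunZ a x : phi (a *: x) = a *: phi x.
Proof. by rewrite -[a *: x]addr0 lphi linfun0 addr0. Qed.

Lemma linfunB x y : phi (x - y) = phi x - phi y.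
Proof. by rewrite linfunD -scaleN1r linfunZ scaleN1r. Qed.

End LinearMaps.

(** * Path integrals, the shift [Zplus] and its eigenfunctions *)

Section Paths.
Context {R : realType} {L : rhombic_lattice R}.
Implicit Types (x y z : vertex L) (p q : seq (vertex L)).

Lemma path_to_cat r x p y q z :
  path_to r x p y -> path_to r y q z -> path_to r x (p ++ q) z.
Proof. by move=> [pp py] [qp qz]; split; rewrite ?cat_path ?last_cat py ?pp. Qed.

Section OneSpace.
Context {V : lmodType R[i]}.
Implicit Types f g : vertex L -> V.

Lemma path_int_cat f x p q :
  path_int f x (p ++ q) = path_int f x p + path_int f (last x p) q.
Proof. by elim: p x => [|y p IH] x /=; rewrite ?add0r // IH addrA. Qed.

Lemma path_int_rev f x p y : path_to (adjacent L) x p y ->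
  exists2 q, path_to (adjacent L) y q x & path_int f y q = - path_int f x p.
Proof.
elim: p x => [|u p IH] x [/=]; first by move=> _ ->; exists [::]; rewrite ?oppr0.
move=> /andP[/asboolP xu pu] py; have [q qu qE] := IH u (conj pu py).
have ux : path_to (adjacent L) u [:: x] x.
  by split=> //=; rewrite andbT; apply/asboolP; apply: adjacent_sym.
exists (q ++ [:: x]); first exact: path_to_cat qu ux.
rewrite path_int_cat (proj2 qu) qE /= addr0 opprD addrC; congr (_ - _).
by rewrite -scaleNr opprB [f u + _]addrC.
Qed.

(** Any two paths from [x] to [y] form a closed path once one is reversed. *)
Lemma dintE f x y p : DA f -> path_to (adjacent L) x p y ->
  dint f x y = path_int f x p.
Proof.
move=> Df xpy; rewrite /dint; case: xgetP => [I _ [q xqy ->]|]; last first.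
  by move=> /(_ (path_int f x p)) []; exists p.
have [r yrx rE] := path_int_rev f xpy.
have := Df _ _ (path_to_cat xqy yrx).
by rewrite path_int_cat (proj2 xqy) rE => /eqP; rewrite subr_eq0 => /eqP.
Qed.

(** With the default value 0 across components, the identities for [Zplus] hold at every vertex
    without appeal to connectedness of the graph. *)
Lemma dint_disconnected f x y : ~ joined (adjacent L) x y -> dint f x y = 0.
Proof.
by rewrite /dint; case: xgetP => // I _ [q xqy _] []; exists q.
Qed.

Lemma path_intB f g x p :
  path_int (f \- g) x p = path_int f x p - path_int g x p.
Proof.
elim: p x => [|y p IH] x /=; rewrite ?subr0 // IH [in RHS]opprD [in RHS]addrACA.
by congr (_ + _); rewrite -scalerBr -scalerBr opprD [in RHS]addrACA.
Qed.

Lemma DA_B f g : DA f -> DA g -> DA (f \- g).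
Proof. by move=> Df Dg x p px; rewrite path_intB Df // Dg // subr0. Qed.

Lemma ZplusB o f g z : DA f -> DA g ->
  Zplus o (f \- g) z = Zplus o f z - Zplus o g z.
Proof.
move=> Df Dg; rewrite /Zplus [in RHS]opprD [in RHS]addrACA; congr (_ + _).
  rewrite -scalerBr /= !opprB addrACA [in RHS]addrACA.
  by rewrite [- f z - _]addrC.
have [[p oz]|noz] := pselect (joined (adjacent L) o z).
  by rewrite !(dintE _ oz) ?path_intB //; apply: DA_B.
by rewrite !dint_disconnected // subr0.
Qed.

Lemma Zplus_base o f : DA f -> Zplus o f o = 0.
Proof.
move=> Df; have oo : path_to (adjacent L) o [::] o by [].
by rewrite /Zplus (dintE Df oo) subrr scaler0 addr0.
Qed.

Lemma Zplus_edge o f z w : DA f -> joined (adjacent L) o z ->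
  adjacent L (val z) (val w) ->
  Zplus o f w - Zplus o f z = 2^-1 *: (f z - f w) +
    (val w - val z) *: (2^-1 *: (f z + f w)).
Proof.
move=> Df [p oz] zw.
have zw1 : path_to (adjacent L) z [:: w] w.
  by split=> //=; rewrite andbT; apply/asboolP.
rewrite /Zplus (dintE Df oz) (dintE Df (path_to_cat oz zw1)) path_int_cat.
rewrite (proj2 oz) /= addr0 opprD addrACA -scalerBr; congr (_ *: _ + _).
  by rewrite opprB addrC addrA subrK.
by rewrite addrC addKr.
Qed.

(** Applied with [u], [v] the values at the end and the start of an edge and [e] its direction. *)
Lemma eigen_edge (a b e : R[i]) (u v : V) :
  a *: (u - v) = b *: (2^-1 *: (v - u) + e *: (2^-1 *: (v + u))) ->
  (2 * a + b * (1 - e)) *: u = (2 * a + b * (1 + e)) *: v.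
Proof.
move=> /eqP; rewrite -subr_eq0 => /eqP h; apply/eqP; rewrite -subr_eq0; apply/eqP.
have two : (2 : R[i]) != 0 by rewrite pnatr_eq0.
have := congr1 (fun v => 2 *: v) h; rewrite scaler0 => <-.
have scale_comb k c d : k *: (c *: u + d *: v) = (k * c) *: u + (k * d) *: v.
  by rewrite scalerDr !scalerA.
have add_comb c d c' d' : c *: u + d *: v + (c' *: u + d' *: v)
    = (c + c') *: u + (d + d') *: v by rewrite addrACA -!scalerDl.
have -> : u - v = 1 *: u + (-1) *: v by rewrite scale1r scaleN1r.
have -> : v - u = (-1) *: u + 1 *: v by rewrite scale1r scaleN1r addrC.
have -> : v + u = 1 *: u + 1 *: v by rewrite !scale1r addrC.
rewrite -[- (b *: _)]scaleN1r !(scale_comb, add_comb) -scaleNr.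
by congr (_ *: _ + _ *: _); field.
Qed.

Lemma direction_neq0 e : directions L e -> e != 0.
Proof.
move=> [z [w [[P _ [b [e1 _ _ _ _]]] ->]]].
by rewrite -normr_eq0 e1 oner_eq0.
Qed.

(* [a = 0], [b = 1] gives the injectivity of [Z_+], [a = 1], [b = t] the absence
   of eigenfunctions of [Z_-] with eigenvalue [t]. *)
Lemma eigenfunction_eq0 o f (a b e : R[i]) : coherent_tracks_on_both_sides L ->
  directions L e -> b != 0 -> 2 * a + b * (1 - e) = 0 -> DA f ->
  (forall z, a *: (f z - f o) = b *: Zplus o f z) -> forall z, f z = 0.
Proof.
move=> tracks de b0 abe Df eig.
have e0 := direction_neq0 de.
have two : (2 : R[i]) != 0 by rewrite pnatr_eq0.
have edge z (w : vertex L) : joined (adjacent L) o z -> adjacent L (val z) (val w) ->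
    (b * (e - (val w - val z))) *: f w = (b * (e + (val w - val z))) *: f z.
  move=> oz zw; have := Zplus_edge Df oz zw.
  move=> /(congr1 ( *:%R b)); rewrite scalerBr -!eig -scalerBr.
  rewrite opprB addrA subrK => /eigen_edge.
  set d := val w - val z.
  have -> : 2 * a + b * (1 - d) = b * (e - d).
    by rewrite -[LHS]subr0 -abe; ring.
  have -> : 2 * a + b * (1 + d) = b * (e + d).
    by rewrite -[LHS]subr0 -abe; ring.
  by [].
have conn z : joined (adjacent L) o z -> f z = 0.
  (* On the edge from [y] to [y + e] the recurrence reads [0 = 2 b e f(y)]. The zero then moves back
     to [z] along edges with [e + d] nonzero. *)
  move=> oz; have [y [zy ye]] := free_edge tracks z de.
  move: z zy oz; apply: joined_ind => [ox|x u [xu ne nNe] _ IH ox].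
    have [w wE] := vertex_of_adjacent (adjacent_sym ye).
    have := edge y w ox; rewrite wE => /(_ ye).
    rewrite (_ : val y + e - val y = e); last by rewrite addrC addKr.
    rewrite subrr mulr0 scale0r => /esym/eqP; rewrite scaler_eq0 mulf_eq0.
    by rewrite (negbTE b0) -mulr2n -mulr_natl mulf_eq0 (negbTE two) (negbTE e0) => /eqP.
  have fu : f u = 0 by apply: IH; apply: joined_trans ox (joined_edge _).
  have := edge _ _ ox xu; rewrite fu scaler0 => /esym/eqP.
  rewrite scaler_eq0 mulf_eq0 (negbTE b0) addrC addr_eq0 => /orP[/eqP|/eqP //].
  by move=> /nNe.
(* Off the component of [o] the integral is 0 by default, and the equation becomes
   [(a + b / 2) f(z) = 0] with [a + b / 2 = b e / 2] nonzero. *)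
move=> z; have [/conn //|noz] := pselect (joined (adjacent L) o z).
have fo := conn o (joined_refl _ _).
have := eig z; rewrite /Zplus dint_disconnected // addr0 fo subr0 sub0r.
rewrite scalerN scalerN scalerA => /eqP; rewrite -addr_eq0 -scalerDl.
rewrite scaler_eq0 => /orP[|/eqP //].
rewrite (_ : a + b / 2 = b * e / 2).
  by rewrite !mulf_eq0 invr_eq0 (negbTE b0) (negbTE e0) (negbTE two).
apply/eqP; rewrite -subr_eq0.
have -> : a + b / 2 - b * e / 2 = (2 * a + b * (1 - e)) / 2 by field.
by rewrite abe mul0r.
Qed.

End OneSpace.

Section TwoSpaces.
Context {V W : lmodType R[i]}.
Variable phi : V -> W.
Hypothesis lphi : linear phi.
Implicit Types f g : vertex L -> V.

Lemma path_int_linear f x p : path_int (phi \o f) x p = phi (path_int f x p).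
Proof.
elim: p x => [|y p IH] x /=; first by rewrite (linfun0 lphi).
by rewrite IH (linfunD lphi) !(linfunZ lphi) (linfunD lphi).
Qed.

Lemma DA_linear f : DA f -> DA (phi \o f).
Proof. by move=> Df x p px; rewrite path_int_linear Df // (linfun0 lphi). Qed.

Lemma Zplus_linear o f z : DA f -> Zplus o (phi \o f) z = phi (Zplus o f z).
Proof.
move=> Df; rewrite /Zplus (linfunD lphi) (linfunZ lphi) (linfunB lphi); congr (_ + _).
have [[p oz]|noz] := pselect (joined (adjacent L) o z).
  by rewrite !(dintE _ oz) ?path_int_linear //; apply: DA_linear.
by rewrite !dint_disconnected // (linfun0 lphi).
Qed.

End TwoSpaces.
End Paths.

(** * The backward shift on the reproducing kernel space *)

Unset Implicit Arguments.
Set Strict Implicit.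
Set Printing Implicit Defensive.

Theorem theorem3p2 (R : realType) (L : rhombic_lattice R)
    (L0 : 0 \in vertices L) (L1 : directions L 1)
    (Ltracks : coherent_tracks_on_both_sides L)
    (M N : hilbertType R)
    (A : M -> M) (bA : bounded_op A)
    (sA : spectrum A `&` lattice_S L = set0)
    (C : M -> N) (bC : bounded_op C) :
  let o : vertex L := exist _ 0 L0 in
  forall (G : vertex L -> M -> M) (hG : is_resolvent_DA o A G),
  let F z := C \o G z in
  let K z w := F z \o adjoint (F w) in
  forall (HK : hilbertType R) (ev : {linear HK -> (vertex L -> N)})
    (hK : is_rkhs K ev),
  (forall f : HK, DA (ev f)) /\
  exists T : HK -> HK,
    [/\ bounded_op T,
        forall f, ev (T f) = Zminus o (ev f) &
        forall t, lattice_S L t -> invertible_op (fun f => t *: f - T f)].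
Proof.
move=> o G [bG DG GA _] F K HK ev [evI repr].
have bF z : bounded_op (F z) by apply: bounded_op_comp.
have lF z : linear (F z) by case: (bF z).
have lC : linear C by case: bC.
pose Gam m : vertex L -> N := fun z => F z m.
(* Evaluation at [m] followed by [C] is linear on the space [M -> M], which carries analyticity and
   [Zplus] from [G] to [Gam m]. *)
pose at_ m (S : M -> M) : N := C (S m).
have lat m : linear (at_ m).
  by move=> a S S'; rewrite /at_ -lC.
have DGam m : DA (Gam m) by exact: (DA_linear (lat m) DG).
have ZGam m z : Zplus o (Gam m) z = C (Zplus o G z m).
  exact: (Zplus_linear (lat m) o z DG).
have GamE m z : Gam m z = C m + Zplus o (Gam (A m)) z.
  have e : G z m - Zplus o G z (A m) = m.
    exact: (congr1 (fun S : M -> M => S m) (GA z)).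
  by rewrite ZGam -[in X in _ = C X + _]e (linfunB lC) subrK.
have Gam_shift m z : Gam m z - Gam m o = Zplus o (Gam (A m)) z.
  by rewrite !GamE Zplus_base // addr0 addrC addKr.
(* The case [a = 0], [b = e = 1], where 1 is a direction by [L1]. *)
have Zinj f : DA f -> (forall z, Zplus o f z = 0) -> forall z : vertex L, f z = 0 :> N.
  move=> Df Zf; apply: (@eigenfunction_eq0 _ _ _ o f 0 1 1) => //.
    by rewrite mulr0 subrr mulr0 addr0.
  by move=> z; rewrite scale0r Zf scaler0.
(* [Gam (A m)] meets the condition defining [Zminus], and injectivity of [Zplus] leaves no other
   choice to [xget]. *)
have ZminusGam m : Zminus o (Gam m) = Gam (A m).
  rewrite /Zminus; case: xgetP => [h _ [Dh hE]|]; last first.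
    by move=> /(_ (Gam (A m))) []; split=> // z; rewrite Gam_shift.
  apply/funext => z; apply/eqP; rewrite -subr_eq0; apply/eqP.
  apply: (Zinj (h \- Gam (A m))); first exact: DA_B.
  by move=> y; rewrite ZplusB // hE Gam_shift subrr.
have /choice[k hk] (i : vertex L * N) : exists k : HK,
    ev k = (fun z => K z i.1 i.2) /\ forall f, hdot f k = hdot (ev f i.1) i.2.
  by have [k ? ?] := repr i.1 i.2; exists k.
(* The vectors [adjoint (F w) n] have the same inner products as the kernel functions, and an [f]
   orthogonal to all kernel functions vanishes at every vertex. *)
have [V [bV Vk Vdot]] : exists V : HK -> M, [/\ bounded_op V,
    forall i, V (k i) = adjoint (F i.1) i.2 &
    forall f i, hdot f (k i) = hdot (V f) (adjoint (F i.1) i.2)].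
  apply: (gram_isometry (m := fun i => adjoint (F i.1) i.2)).
    move=> i j; have [kiE _] := hk i; have [_ ->] := hk j; rewrite kiE /K /=.
    by rewrite (adjointP (bF _)).
  move=> f hf; apply: evI; rewrite linear0; apply/funext => w.
  apply: dot_self_eq0; have [_ <-] := hk (w, ev f w).
  exact: hf.
pose U := adjoint V.
have bU : bounded_op U by apply: adjoint_bounded.
have dot_injl (x y : N) : (forall n, hdot x n = hdot y n) -> x = y.
  by move=> h; apply: dot_inj => n; rewrite dotC h -dotC.
have evV f : ev f = Gam (V f).
  apply/funext => w; apply: dot_injl => n.
  by have [_ /(_ f) <-] := hk (w, n); rewrite Vdot /Gam (adjointP (bF w)).
have evU q : ev (U q) = Gam q.
  apply/funext => w; apply: dot_injl => n.
  have [_ /(_ (U q)) <-] := hk (w, n).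
  rewrite dotC -(adjointP bV) -dotC Vk.
  by rewrite /Gam (adjointP (bF w)).
have GamB x y : Gam (x - y) = Gam x - Gam y.
  by apply/funext => z; rewrite /Gam (linfunB (lF z)).
have GamZ a x : Gam (a *: x) = a *: Gam x.
  by apply/funext => z; rewrite /Gam (linfunZ (lF z)).
split=> [f|]; first by rewrite evV.
exists (U \o A \o V); split.
- by apply: bounded_op_comp => //; apply: bounded_op_comp.
- by move=> f /=; rewrite evU evV ZminusGam.
move=> t St; have [B [bB BA AB]] : invertible_op (fun x => t *: x - A x).
  apply: contrapT => h.
  by have : (spectrum A `&` lattice_S L) t by []; rewrite sA.
have lB : linear B by case: bB.
(* If it failed, [Gam r] with [r = B (x - y)] would be a nonzero eigenfunction of [Zminus] with
   eigenvalue [t]. *)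
have kerB x y : Gam x = Gam y -> Gam (B x) = Gam (B y).
  move=> xy; have [e de te] := St.
  have t0 : t != 0.
    apply/eqP => t0; move: te; rewrite t0 mul0r addr0 => /eqP.
    by rewrite pnatr_eq0.
  pose r := B (x - y).
  have rE : t *: r - A r = x - y.
    exact: (congr1 (fun S : M -> M => S (x - y)) AB).
  have GrE : Gam (A r) = t *: Gam r.
    apply/esym/eqP; rewrite -subr_eq0 -GamZ -GamB rE GamB xy subrr.
    exact: eqxx.
  have r0 : forall z, Gam r z = 0.
    apply: (@eigenfunction_eq0 _ _ _ o (Gam r) 1 t e) => //.
      by rewrite mulr1.
    move=> z; rewrite scale1r Gam_shift GrE.
    have lt : linear ( *:%R t : N -> N).
      by move=> a u v; rewrite scalerDr !scalerA mulrC.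
    exact: (Zplus_linear lt o z (DGam r)).
  apply/eqP; rewrite -subr_eq0 -GamB -(linfunB lB).
  by apply/eqP/funext.
exists (U \o B \o V); split.
- by apply: bounded_op_comp => //; apply: bounded_op_comp.
- apply/funext => f; apply: evI; rewrite /= evU evV.
  transitivity (Gam (B (t *: V f - A (V f)))); last first.
    by congr Gam; exact: (congr1 (fun S : M -> M => S (V f)) BA).
  apply: kerB; rewrite -evV linearB linearZ /= evU evV GamB GamZ.
  by [].
- apply/funext => f; apply: evI; rewrite /= linearB linearZ /= !evU.
  (* [V \o U] need not be the identity, but [Gam] does not see the difference, and by [ZminusGam]
     neither does [Gam \o A]. *)
  have -> : Gam (A (V (U (B (V f))))) = Gam (A (B (V f))).
    by rewrite -!ZminusGam -evV evU.
  rewrite -GamZ -GamB evV; congr Gam.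
  exact: (congr1 (fun S : M -> M => S (V f)) AB).
Qed.
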